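(* Let $\alpha>3$ be a quadratic unit whose conjugate $\alpha_2$ is negative; thus $\alpha$ is a root of $x^2-bx-1$ for a positive integer $b$. Define integer sequences $(p_n)_{n\ge0}$, $(q_n)_{n\ge0}$ by \[ p_0=0,\ p_2=b,\ p_{2n+2}=(b^2+2)p_{2n}-p_{2n-2},\ p_{2n-1}=p_{2n-2}+p_{2n}, \] \[ q_0=1,\ q_2=b^2+3,\ q_{2n+2}=(b^2+2)q_{2n}-q_{2n-2},\ q_{2n-1}=q_{2n-2}+q_{2n} \] for all integers $n\ge1$. Then $(p_n/q_n)_{n\ge0}$ is strictly increasing and converges to $b/(1+\alpha^2)$, and \[ \left\{\limsup_{m\to\infty}\|\xi\alpha^m\| : \xi\in\mathbb{R}\right\}\cap\left[0,\frac{b}{1+\alpha^2}\right]=\left\{\frac{p_n}{q_n} : n=0,1,2,\ldots\right\}\cup\left\{\frac{b}{1+\alpha^2}\right\}. \] Moreover, for each $n\ge0$ the set $X_n=\{\xi\in\mathbb{R} : \limsup_{m\to\infty}\|\xi\alpha^m\|=p_n/q_n\}$ is a subset of $\mathbb{Q}(\alpha)$, and the set $X_\infty=\{\xi\in\mathbb{R} : \limsup_{m\to\infty}\|\xi\alpha^m\|=b/(1+\alpha^2)\}$ is uncountable.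
   Context: $\|x\|$ denotes the distance from the real number $x$ to the nearest integer. *)

(* Defs.v *)
From HB Require Import structures.
From mathcomp Require Import all_boot all_order all_algebra.
From mathcomp Require Import all_classical all_reals all_analysis.

Set Implicit Arguments.
Unset Strict Implicit.
Unset Printing Implicit Defensive.

Import Order.TTheory GRing.Theory Num.Theory.
Import numFieldNormedType.Exports.

Local Open Scope classical_set_scope.
Local Open Scope ring_scope.

(* The infimum is over a nonempty set bounded below by 0. *)
Definition dist_int (R : realType) (x : R) : R :=
  inf [set `|x - k%:~R| | k in [set: int]].

Definition minimal_poly (R : realType) (x : R) (f : {poly rat}) : Prop :=
  [/\ f \is monic, irreducible_poly f & root (map_poly ratr f) x].

Definition algebraic_integer (R : realType) (x : R) : Prop :=
  integralOver (intr : int -> R) x.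

Definition quadratic_unit (R : realType) (x : R) : Prop :=
  [/\ algebraic_integer x, algebraic_integer x^-1 &
      exists2 f, minimal_poly x f & size f = 3%N].

(* [y] is a root of the minimal polynomial of [x]; [y = x] is not excluded. *)
Definition conjugate_over_rat (R : realType) (x y : R) : Prop :=
  exists2 f, minimal_poly x f & root (map_poly ratr f) y.

(* Q(x): the smallest subfield of R containing x. *)
Definition rat_adjoin (R : realType) (x : R) : set R :=
  [set y | forall S : {pred R}, divring_closed S -> x \in S -> y \in S].

(* Since n >= 1, the truncated subtractions on indices are exact. *)
Definition recurrence (b : int) (s : nat -> int) : Prop :=
  forall n : nat, (1 <= n)%N ->
    s (2 * n + 2)%N = (b ^+ 2 + 2) * s (2 * n)%N - s (2 * n - 2)%N /\
    s (2 * n - 1)%N = s (2 * n - 2)%N + s (2 * n)%N.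

(* The initial values s 0 and s 2 can be prescribed freely. *)
Lemma recurrence_exists (b x y : int) :
  exists s : nat -> int, [/\ s 0%N = x, s 2%N = y & recurrence b s].
Proof.
pose e k := (iter k (fun u : int * int =>
  (u.2, (b ^+ 2 + 2) * u.2 - u.1)) (x, y)).1.
exists (fun n => if odd n then e n./2 + e n./2.+1 else e n./2).
split=> // -[//|n] _.
have -> : (2 * n.+1 + 2 = n.+2.*2)%N by rewrite mul2n addn2.
have -> : (2 * n.+1 - 2 = n.*2)%N by rewrite mul2n doubleS subn2.
have -> : (2 * n.+1 - 1 = n.*2.+1)%N by rewrite mul2n doubleS subn1.
rewrite mul2n; set m := n.+1; rewrite /= !odd_double /= !doubleK uphalf_double.
by split.
Qed.

(* The sequence ||xi * alpha^m|| takes values in [0, 1/2], where [limn_sup] is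
   the usual limit superior. *)
Definition limsup_dist (R : realType) (alpha xi : R) : R :=
  limn_sup (fun m : nat => dist_int (xi * alpha ^+ m)).

(* Main.v *)
Require Import Defs.
From HB Require Import structures.
From mathcomp Require Import all_boot all_order all_algebra.
From mathcomp Require Import all_classical all_reals all_analysis.
From mathcomp Require Import zify ring lra.
Import Order.TTheory GRing.Theory Num.Theory.
Import numFieldNormedType.Exports.
Local Open Scope classical_set_scope.
Local Open Scope ring_scope.

Set Implicit Arguments.
Unset Strict Implicit.
Unset Printing Implicit Defensive.

(* Let x = 1/alpha < 1/3, let u_m be the integer nearest to xi alpha^m and
   eps_m = xi alpha^m - u_m.  The integers s_m = u_(m+2) - b u_(m+1) - u_m satisfy
   (alpha + x) eps_(m+1) = s_m + sum_(j >= 1) x^j (s_(m+j) + (-1)^j s_(m-j)),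
   up to an exponentially small error.  If limsup |eps_m| is smaller than
   L = (1 - x^2) / (alpha + x), then s_m is eventually in {-1, 0, 1} and, as
   x < 1/3, the resulting inequalities are lexicographic conditions on the
   digits.  They force the nonzero s_m to alternate in sign and to lie in one
   parity class, so that s consists of the differences v_(j+1) - v_j of a 0/1
   word v, and they become Markoff's property of v: at every boundary
   v_j <> v_(j+1) the two halves of v, read outwards, differ, and at their first
   difference each half shows the boundary letter of the other one.  By
   desubstitution such a word is eventually constant or periodic with period
   n + 1, where n is the largest distance of a first difference from its
   boundary, and then the limsup is p_n/q_n and xi lies in Q(alpha).  Conversely
   every bounded s comes from some xi; periodic words give the values p_n/q_n,
   and words whose 1s have gaps tending to infinity give L. *)

(** * Words with the Markoff property *)

(** The strict inequality limsup < L leaves a margin, so the two-sided series can be cut after N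
    terms with the same N for all large m. This N then bounds the gaps of s and the distance of a
    first difference from its boundary in v. Each desubstitution lowers it by at least one, which is
    why the descent stops. At L itself no such N need exist: the words with growing gaps have
    unbounded distances, and there are uncountably many of them. The values arise as follows. Put y
    = x^2. At a boundary of v only even distances contribute, and summation by parts turns the
    series into (1 - y) \sum_i y^i D_i, where D_0 = 1 and D_i in {-1, 0, 1} compares the two halves
    at distance i. If the halves agree at every positive distance the sum is 1, which gives L. If v
    has period P and the first difference is at P - 1, then D_i is 1 at multiples of P, -1 just
    before them and 0 elsewhere, and the sum is (1 - y^(P-1)) / (1 - y^P). Positions with s_m = 0
    have to be shown harmless separately; x < 1/3 suffices for this as well. *)

Section MarkoffWords.
Local Open Scope nat_scope.

Ltac arith :=
  repeat match goal with v : nat -> bool |- _ =>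
    match goal with H : context [v _] |- _ => clear H end end; lia.

(** The uniform bound [N] on the distance of the first difference is the induction parameter of
    [markoff_tame]. Subtraction of positions is truncated; a threshold [M >= N] makes [j - k]
    exact. *)
Definition markoff (v : nat -> bool) (M N : nat) : Prop :=
  forall j, M <= j -> v j != v j.+1 ->
    exists k, [/\ 0 < k <= N, forall i, 0 < i < k -> v (j.+1 + i) = v (j - i),
                  v (j.+1 + k) = v j & v (j - k) = v j.+1].

(** Far out, the boundaries of the last clause have their first difference at distance exactly
    [P.-1], since period [P] gives v (j + P) = v j and v (j + 1 - P) = v (j + 1). The clause says
    that this largest possible distance keeps being reached. *)
Definition deep_periodic (v : nat -> bool) (P : nat) : Prop :=
  [/\ 1 < P, exists M, forall j, M <= j -> v (j + P) = v j &
      forall A, exists j, [/\ A <= j, v j != v j.+1 &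
        forall i, 0 < i < P.-1 -> v (j.+1 + i) = v (j - i)]].

Lemma markoff_negb v M N : markoff v M N -> markoff (negb \o v) M N.
Proof.
move=> mv j Mj /= vj; have [||k [k0 kE k1 k2]] := mv j => //.
  by apply: contraNneq vj => ->.
by exists k; split=> //= [i /kE ->||]; rewrite ?k1 ?k2.
Qed.

Lemma deep_periodic_negb v P : deep_periodic (negb \o v) P -> deep_periodic v P.
Proof.
case=> P1 [M vP] dP; split=> //.
  by exists M => j /vP /negb_inj.
move=> A; have [j [Aj vj ji]] := dP A.
by exists j; split=> // [|i /ji /negb_inj //]; apply: contraNneq vj => /= ->.
Qed.

(* If a square is followed by the opposite one, reflecting a shortest stretch
   between two such squares across its last boundary produces a shorter such
   stretch to its right. *)
Lemma markoff_no_opposite_squares v M N d a : markoff v M N -> M <= a ->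
  v a = v a.+1 -> v (a + d) = v (a + d).+1 -> v (a + d) = v a.
Proof.
move=> mv; elim/ltn_ind: d a => d IH a Ma va vd.
apply/eqP; apply: contraT => nvd.
have d0 : 1 < d.
  case: d {IH} nvd vd => [|[|d]] //; first by rewrite addn0 eqxx.
  by rewrite addn1 -va eqxx.
have alt i : 0 < i < d -> v (a + i) != v (a + i).+1.
  move=> /andP[i0 id]; apply/negP => /eqP vi.
  have h1 := IH i id a Ma va vi.
  have h2 := IH (d - i) ltac:(arith) (a + i) ltac:(arith) vi.
  rewrite (_ : a + i + (d - i) = a + d) in h2; last arith.
  by rewrite h2 // h1 eqxx in nvd.
have altE i : i < d -> v (a + i.+1) = odd i (+) v a.
  elim: i => [|i IHi] id; first by rewrite addn1 -va.
  have := alt i.+1 id; rewrite -addnS IHi; last arith.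
  by rewrite /=; case: (v _) (v a) (odd i) => [] [] [].
have dE : ~~ odd d.
  have := altE d.-1 ltac:(arith); rewrite prednK; last arith.
  move=> h; move: nvd; rewrite h; case: d d0 {IH alt altE h vd} => //= d _.
  by case: (odd d) (v a) => [] [].
set j := a + d.-1.
have vj : v j = v a.
  have := altE d.-2 ltac:(arith); rewrite /j (_ : d.-2.+1 = d.-1); last arith.
  move=> ->; case: d d0 dE {IH vd nvd alt altE j} => [|[|d]] //= _.
  by rewrite negbK => /negbTE ->.
have jS : j.+1 = a + d by rewrite /j; arith.
have nvj : v j != v j.+1 by rewrite vj jS eq_sym.
have [|k [/andP[k0 kN] kE k1 k2]] := mv j _ nvj; first by rewrite /j; arith.
have v1 : v j.+1.+1 = ~~ v a.
  by rewrite jS -vd; case: (v _) (v a) nvd => [] [].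
have vj1 : v j.+1 = ~~ v a.
  by rewrite jS; case: (v _) (v a) nvd => [] [].
have jb i : i <= d - 2 -> v (j - i) = odd i (+) v a.
  move=> id; have -> : j - i = a + (d - 2 - i).+1 by rewrite /j; arith.
  rewrite altE; last arith.
  by rewrite oddB // oddB //= (negbTE dE).
have k3 : 3 <= k.
  case: k k0 kN kE k1 k2 => [|[|[|k]]] // _ _ kE.
    rewrite addn1 v1 vj => /esym /eqP.
    by case: (v a).
  rewrite vj => h; have := kE 1 isT; rewrite addn1 v1 => h1 h2.
  move: h2; rewrite jS.
  have [h3|h3] : d = 2 \/ 2 < d by arith.
    have : v (j - 1) = v a.
      by have -> : j - 1 = a by rewrite /j; arith.
    by rewrite -h1; case: (v a).
  have := jb 2 ltac:(arith) => /= -> h4.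
  by rewrite -h4 eqxx in nvd.
have d2 : 2 < d.
  have [h3|//] : d = 2 \/ 2 < d by arith.
  have := kE 1 ltac:(arith); rewrite addn1 v1.
  have -> : j - 1 = a by rewrite /j; arith.
  by case: (v a).
(* If the first difference lies inside the stretch, alternation makes [k] odd. Then j + k and j + k
   + 1 form a square of the letter [v a], at distance k - 1 from the opposite square at j + 1. *)
have [kd|kd] := ltnP k (d - 1).
  have ok : odd k.
    have := jb k ltac:(arith); rewrite k2 => h.
    by move: nvj; rewrite vj h; case: (odd k) (v a) => [] [].
  have vk : v (j + k) = v a.
    have -> : j + k = j.+1 + k.-1 by arith.
    rewrite kE; last arith.
    rewrite jb; last arith.
    by rewrite -subn1 oddB // ok.
  have := IH k.-1 ltac:(arith) j.+1 ltac:(arith).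
  have -> : j.+1 + k.-1 = j + k by arith.
  have -> : (j + k).+1 = j.+1 + k by arith.
  rewrite k1 vj vk vj1 v1 => h.
  by have := h erefl erefl; case: (v a).
have vk : v (j.+1 + (d - 2)) = v a.
  rewrite kE; last arith.
  rewrite jb // oddB; last arith.
  by rewrite (negbTE dE).
have [kd1|kd1] : k = d - 1 \/ d - 1 < k by arith.
  move: k2; rewrite kd1 jS (_ : j - (d - 1) = a); last by rewrite /j; arith.
  by move=> h; rewrite -h eqxx in nvd.
(* Now k > d - 1, so the square at [a] is itself reflected, to a square at distance d - 2 from the
   opposite one at j + 1. *)
have vk1 : v (j.+1 + (d - 1)) = v a.
  by rewrite kE; [congr v; rewrite /j; arith|arith].
have := IH (d - 2) ltac:(arith) j.+1 ltac:(arith).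
rewrite vk (_ : (j.+1 + (d - 2)).+1 = j.+1 + (d - 1)); last arith.
rewrite vk1 v1 vj1 => h.
by have := h erefl erefl; case: (v a).
Qed.

(* [desub v m] inverts the substitution 0 -> 0, 1 -> 01 on the suffix of [v]
   starting at [m]; [desub_pos v m i] is where the image of letter [i] starts. *)
Definition desub_pos (v : nat -> bool) (m i : nat) : nat :=
  iter i (fun t => t + 1 + v t.+1) m.

Definition desub (v : nat -> bool) (m i : nat) : bool := v (desub_pos v m i).+1.

Arguments desub_pos : simpl never.

Section Desubstitution.
Variables (v : nat -> bool) (m : nat).
Hypothesis vm : v m = false.
Hypothesis v11 : forall j, m <= j -> v j -> v j.+1 = false.
Local Notation t := (desub_pos v m).
Local Notation w := (desub v m).

Lemma desub_posS i : t i.+1 = t i + 1 + w i.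
Proof. by []. Qed.

Lemma desub_pos_ge i : m + i <= t i.
Proof. by elim: i => [|i IH]; rewrite ?addn0 // desub_posS; arith. Qed.

Lemma desub_pos_le i k : t i <= t (i + k).
Proof. by elim: k => [|k IH]; rewrite ?addn0 // addnS desub_posS; arith. Qed.

Lemma desub_start i : v (t i) = false.
Proof.
elim: i => [//|i IH]; rewrite desub_posS /desub.
case E: (v (t i).+1); rewrite /= ?addn0 !addn1 //.
by apply: v11 => //; have := desub_pos_ge i; arith.
Qed.

(** Both images 0 and 01 end with the letter they encode, while [desub] reads the letter after the
    initial 0. Thus [w i] is visible from either side, which lets reflections pass between [v] and
    [w]. *)
Lemma desub_end i : v (t i.+1).-1 = w i.
Proof.
rewrite desub_posS /desub; case E: (v (t i).+1); rewrite /= ?addn0 !addn1 //.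
exact: desub_start.
Qed.

Lemma desub_cover i0 c : t i0 <= c ->
  exists2 i, i0 <= i & c = t i \/ c = (t i).+1 /\ w i.
Proof.
move=> /subnKC <-; elim: (c - t i0) => [|d [i i0i [h|[h wi]]]].
- by rewrite addn0; exists i0 => //; left.
- have := desub_posS i; case E: (w i) => /= e.
    by exists i => //; right; split=> //; rewrite -h; arith.
  by exists i.+1; [arith|left; rewrite e -h; arith].
- have := desub_posS i; rewrite wi /= => e.
  by exists i.+1; [arith|left; rewrite e; arith].
Qed.

(** An image together with the initial 0 of the next one is 00 or 010, a palindrome. Chaining these,
    reversing a stretch of [w] reverses its image in [v]. *)
Lemma desub_reflect a b k : k <= b ->
  (forall l, l < k -> w (a + l) = w (b - l.+1)) ->
  t (a + k) + t (b - k) = t a + t b /\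
  forall c, c <= t (a + k) - t a -> v (t a + c) = v (t b - c).
Proof.
elim: k => [|k IH] kb wab.
  rewrite addn0 subn0; split=> // c; rewrite subnn leqn0 => /eqP ->.
  by rewrite addn0 subn0 !desub_start.
have [|l lk|tk vk] := IH; first by arith.
  by apply: wab; arith.
have e1 := desub_posS (a + k).
have e2 := desub_posS (b - k.+1).
have wk := wab k (ltnSn k).
rewrite (_ : (b - k.+1).+1 = b - k) in e2; last by arith.
rewrite wk in e1; rewrite addnS.
have g := desub_pos_le a k.
split; first by arith.
move=> c ck; have [|ck1] := leqP c (t (a + k) - t a); first exact: vk.
have v1 : v (t (a + k)).+1 = v (t (b - k)).-1.
  have := desub_end (b - k.+1).
  by rewrite (_ : (b - k.+1).+1 = b - k); [move=> ->; exact: wk|arith].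
have [wE|wE] : w (b - k.+1) \/ w (b - k.+1) = false by case: (w _); auto.
  have [cE|cE] : c = (t (a + k) - t a).+1 \/ c = (t (a + k) - t a).+2.
    by clear vk wab IH wk v1; rewrite wE /= in e1; lia.
    have -> : t a + c = (t (a + k)).+1 by clear -cE g; lia.
    by have -> : t b - c = (t (b - k)).-1 by clear -cE tk g; lia.
  rewrite wE in e1 e2.
  have -> : t a + c = t (a + k).+1 by clear -cE g e1; lia.
  have -> : t b - c = t (b - k.+1) by clear -cE tk g e2; lia.
  by rewrite !desub_start.
have cE : c = (t (a + k) - t a).+1.
  by rewrite wE in e1; clear -e1 ck ck1; lia.
have -> : t a + c = (t (a + k)).+1 by clear -cE g; lia.
by have -> : t b - c = (t (b - k)).-1 by clear -cE tk g; lia.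
Qed.

(* A boundary between letters [i] and [i+1] of the desubstituted word sits at
   position [t i + 1] of [v], since [t (i + 2) = t i + 3]. *)
Lemma desub_boundary i k : w i != w i.+1 -> 0 < k <= i.+1 ->
  (forall l, 0 < l < k -> w (i.+1 + l) = w (i - l)) ->
  [/\ t i.+2 = t i + 3, v (t i).+2 = w i.+1,
      t (i.+1 + k) + t (i.+1 - k) = t i.+2 + t i &
      forall c, 0 < c < t (i.+1 + k) - t i ->
        c.+1 < t (i.+1 + k) - t i -> v ((t i).+2 + c) = v ((t i).+1 - c)].
Proof.
move=> wi /andP[k0 ki] wl.
have e1 : t i.+2 = t i + 3.
  by rewrite !desub_posS; move: wi; case: (w i) (w i.+1) => [] [] // _; lia.
have [||tk vk] := @desub_reflect i.+2 i k.-1; first by lia.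
  move=> l lk; rewrite (_ : i.+2 + l = i.+1 + l.+1); last by lia.
  by apply: wl; lia.
rewrite (_ : i.+2 + k.-1 = i.+1 + k) in tk vk; last by lia.
rewrite (_ : i - k.-1 = i.+1 - k) in tk; last by lia.
have := desub_pos_le i.+2 k.-1.
rewrite (_ : i.+2 + k.-1 = i.+1 + k); last by lia.
move=> g; split=> //.
  by rewrite -desub_end e1; congr v; lia.
move=> c /andP[c0 _] c1.
rewrite (_ : (t i).+2 + c = t i.+2 + c.-1); last by clear -e1 c0; lia.
rewrite (_ : (t i).+1 - c = t i - c.-1); last by clear -c0; lia.
by apply: vk; clear -c0 c1 e1 g; lia.
Qed.

End Desubstitution.
(** Images are longer than the words: one of the two letters at a boundary of the desubstituted word
    is a 1, whose image has length 2. A first difference at distance l there therefore comes from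
    one at a distance larger than l in [v], and the bound drops from [N.+1] to [N]. The new
    threshold [N.+1] keeps the truncated subtractions exact. *)
Lemma markoff_desub v m M N : v m = false ->
  (forall j, m <= j -> v j -> v j.+1 = false) ->
  markoff v M N.+1 -> M <= m -> markoff (desub v m) N.+1 N.
Proof.
move=> vm v11 mv Mm i iN wi.
have [e1 e2 _ _] := desub_boundary vm v11 wi (isT : 0 < 1 <= i.+1)
  ltac:(by case=> // l; rewrite andbF).
have tm := desub_pos_ge v m i.
have [||k [/andP[k0 kN] kE k1 k2]] := mv (desub_pos v m i).+1.
- by arith.
- by rewrite e2.
have e3 : v (desub_pos v m i).+1 = desub v m i by [].
rewrite e2 e3 in k1 k2.
set P := fun l => (0 < l) && (desub v m (i.+1 + l) != desub v m (i - l)).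
(* Otherwise [desub_boundary] would extend the mirror symmetry of [v] to distance [k] itself. *)
have [l0 /andP[l00 l0k] Pl0] : exists2 l, 0 < l < k & P l.
  apply: contrapT => nP.
  have wE l : 0 < l < k -> desub v m (i.+1 + l) = desub v m (i - l).
    move=> /andP[l0 lk]; apply/eqP; apply: contraT => h.
    by case: nP; exists l; [apply/andP|apply/andP].
  have kI : 0 < k <= i.+1 by rewrite k0; arith.
  have [_ _ _ h] := desub_boundary vm v11 wi kI wE.
  have ge := desub_pos_ge.
  have tk : desub_pos v m i.+2 + k.-1 <= desub_pos v m (i.+1 + k).
    rewrite (_ : i.+1 + k = i.+2 + k.-1); last by arith.
    by elim: (k.-1) => [|q IH]; rewrite ?addn0 // !addnS (desub_posS v m (i.+2 + q)); arith.
  have := h k ltac:(arith) ltac:(arith).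
  by move=> h1; move: wi; rewrite -k1 h1 k2 eqxx.
have [l /andP[l1 wl] lmin] := @ex_minnP P (ex_intro _ l0 Pl0).
have ll0 := lmin _ Pl0.
have wE q : 0 < q < l -> desub v m (i.+1 + q) = desub v m (i - q).
  move=> /andP[q0 ql]; apply/eqP; apply: contraT => h.
  by have := lmin q ltac:(by apply/andP); arith.
have lI : 0 < l <= i.+1 by rewrite l1; arith.
have [_ _ tl h] := desub_boundary vm v11 wi lI wE.
set C := desub_pos v m (i.+1 + l) - desub_pos v m i.
have tg : desub_pos v m i.+2 <= desub_pos v m (i.+1 + l).
  rewrite (_ : i.+1 + l = i.+2 + l.-1); last by arith.
  exact: desub_pos_le.
have f1 : v ((desub_pos v m i).+2 + C.-1) = desub v m (i.+1 + l).
  by rewrite /desub; congr v; rewrite /C; arith.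
have f2 : v ((desub_pos v m i).+1 - C.-1) = desub v m (i - l).
  rewrite -(desub_end vm v11); congr v.
  rewrite (_ : (i - l).+1 = i.+1 - l); last by arith.
  by rewrite /C; arith.
have kC : k = C.-1.
  have [kC|kC|//] := ltngtP k C.-1.
    have := h k ltac:(by rewrite /C in kC; arith) ltac:(by rewrite /C in kC; arith).
    by move=> h1; move: wi; rewrite -k1 h1 k2 eqxx.
  have := kE C.-1 ltac:(by rewrite /C in kC *; arith).
  by rewrite f1 f2 => h1; rewrite h1 eqxx in wl.
rewrite kC f1 in k1; rewrite kC f2 in k2.
exists l; split=> //.
by rewrite l1 /=; arith.
Qed.

Definition tame (v : nat -> bool) : Prop :=
  (exists M c, forall j, M <= j -> v j = c) \/ exists P, deep_periodic v P.

Lemma tame_negb v : tame (negb \o v) -> tame v.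
Proof.
case=> [[M [c vc]]|[P /deep_periodic_negb]]; last by right; exists P.
by left; exists M, (~~ c) => j /vc <- /=; rewrite negbK.
Qed.

(** A word ending in 1s unfolds to 0101..., the source of period 2. Otherwise a period [P] unfolds
    to the length p of its image, and by [desub_boundary] agreement below [P.-1] becomes agreement
    below [p.-1]. *)
Lemma tame_desub v m : v m = false ->
  (forall j, m <= j -> v j -> v j.+1 = false) -> tame (desub v m) -> tame v.
Proof.
move=> vm v11; set t := desub_pos v m; set w := desub v m.
have tS i : t i.+1 = t i + 1 + w i by [].
have ti i : m + i <= t i by exact: desub_pos_ge.
have cov i0 c : t i0 <= c -> exists2 i, i0 <= i & c = t i \/ c = (t i).+1 /\ w i.
  exact: desub_cover.
have vt i : v (t i) = false by exact: (desub_start vm v11).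
case=> [[M [[] wc]]|[P [P1 [M wP] dP]]].
- right; exists 2; split=> //.
    exists (t M) => c /cov[i Mi [->|[-> wi]]].
      have -> : t i + 2 = t i.+1 by rewrite tS wc //; arith.
      by rewrite !vt.
    have -> : (t i).+1 + 2 = (t i.+1).+1 by rewrite tS wc //; arith.
    by rewrite -[LHS]/(w i.+1) -[RHS]/(w i) !wc //; arith.
  move=> A; exists (t (M + A)); split; first by have := ti (M + A); arith.
    by rewrite vt -[v _.+1]/(w (M + A)) wc //; arith.
  by move=> i /=; arith.
- left; exists (t M), false => c /cov[i Mi [->|[-> wi]]]; first exact: vt.
  by rewrite wc in wi.
right; set p := t (M + P) - t M.
have tP i : M <= i -> t (i + P) = t i + p.
  move=> /subnKC <-; elim: (i - M) => [|d IHd].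
    have := desub_pos_le v m M P; rewrite addn0 -/t /p => h.
    by clear -h; lia.
  rewrite !addnS addSn !tS IHd wP; last by arith.
  by clear; lia.
have pE i : M <= i -> w i != w i.+1 -> t (i + P) = t i.+2 + (p - 3) /\ 3 <= p.
  move=> Mi wi; rewrite tP //.
  have [e1 _ _ _] := @desub_boundary v m vm v11 i 1 wi isT
    ltac:(by case=> // l; rewrite andbF).
  have : t i.+2 <= t (i + P).
    rewrite (_ : i + P = i.+2 + (P - 2)); last by arith.
    exact: desub_pos_le.
  by rewrite tP // -/t in e1 *; rewrite e1; clear; lia.
exists p; split.
- have [i [Mi wi _]] := dP M.
  by have [_] := pE i Mi wi; lia.
- exists (t M) => c /cov[i Mi [->|[-> wi]]].
    by rewrite -tP // !vt.
  have -> : (t i).+1 + p = (t (i + P)).+1 by rewrite tP.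
  by rewrite -[LHS]/(w (i + P)) -[RHS]/(w i) wP.
move=> A; have [i [Ai wi wl]] := dP (A + M + P).
have Mi : M <= i by arith.
have kI : 0 < P.-1 <= i.+1 by arith.
have [e1 e2 _ h] := desub_boundary vm v11 wi kI wl.
have tA := ti i.
exists (t i).+1; split; first by arith.
  by rewrite -/t in e2; rewrite e2 -[v _]/(w i).
rewrite (_ : i.+1 + P.-1 = i + P) in h; last by arith.
move=> c cp; apply: h; rewrite -/t tP //; clear -cp; lia.
Qed.

(** Induction on [N]; for [N = 0] no boundary is left. Otherwise 00 and 11 cannot both occur far
    out, so after complementing if necessary 11 is absent and the word can be desubstituted. *)
Lemma markoff_tame N v M : markoff v M N -> tame v.
Proof.
elim: N v M => [|N IH] v M mv.
  left; exists M, (v M) => j /subnKC <-; elim: (j - M) => [|d vd].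
    by rewrite addn0.
  rewrite addnS -vd; apply/eqP; apply: contraT => nv.
  have [||k [+ _ _ _]] := mv (M + d); [by arith|by rewrite eq_sym|by arith].
suff no11 u : markoff u M N.+1 ->
    (forall j, M.+1 <= j -> u j -> u j.+1 = false) -> tame u.
  have [[j /andP[Mj /andP[vj vj1]]]|nj] :=
      pselect (exists j, (M < j) && (v j && v j.+1)); last first.
    apply: no11 => // j Mj vj; apply/negbTE/negP => vj1.
    by apply: nj; exists j; rewrite Mj vj vj1.
  have [[j0 /andP[Mj0 /andP[vj0 vj01]]]|nj0] :=
      pselect (exists j, (M < j) && (~~ v j && ~~ v j.+1)); last first.
    apply: tame_negb; apply: no11; first exact: markoff_negb.
    move=> j' Mj' /= vj'; apply/negbTE/negP => vj1'.
    by apply: nj0; exists j'; rewrite Mj' vj' vj1'.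
  have sq := markoff_no_opposite_squares mv.
  have [jj|jj] := leqP j j0.
    have := @sq (j0 - j) j (ltnW Mj); rewrite subnKC // vj vj1.
    rewrite (negbTE vj0) (negbTE vj01).
    by move=> /(_ erefl erefl).
  have := @sq (j - j0) j0 (ltnW Mj0); rewrite subnKC ?(ltnW jj) // vj vj1.
  rewrite (negbTE vj0) (negbTE vj01).
  by move=> /(_ erefl erefl).
move=> mu u11.
have [m Mm um] : exists2 m, M < m & u m = false.
  case E: (u M.+1); last by exists M.+1.
  by exists M.+2 => //; exact: u11.
have u11m j : m <= j -> u j -> u j.+1 = false by move=> mj; apply: u11; arith.
apply: (tame_desub um u11m); apply: IH.
by apply: (markoff_desub um u11m mu); arith.
Qed.

End MarkoffWords.

(** * From lexicographic conditions to words *)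

(* For [s m = 1], the limsup bound says that [\sum_(j >= 1) x ^+ j * digit s m j]
   is negative; the extra 1 at [j = 2] comes from the [x ^+ 2] in the bound. *)
Definition digit (s : nat -> int) (m j : nat) : int :=
  s m * (s (m + j)%N + (if odd j then - s (m - j)%N else s (m - j)%N))
  + (j == 2%N)%:Z.

Definition lex_neg (s : nat -> int) (M N : nat) : Prop :=
  forall m, (M <= m)%N -> `|s m| <= 1 /\ (s m != 0 ->
    exists k, [/\ (0 < k <= N)%N, digit s m k < 0 &
                  forall j, (0 < j < k)%N -> digit s m j = 0]).

Section LexNeg.
Variables (s : nat -> int) (M N : nat).
Hypothesis sP : lex_neg s M N.

Lemma lex_neg_val m : (M <= m)%N -> [\/ s m = 0, s m = 1 | s m = -1].
Proof.
move=> /sP[h _]; have : s m = 0 \/ s m = 1 \/ s m = -1 by lia.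
by case=> [|[|]] ->; [constructor 1|constructor 2|constructor 3].
Qed.

Lemma lex_neg_le m k : (M <= m)%N -> s m != 0 -> (0 < k)%N ->
  (forall j, (0 < j < k)%N -> digit s m j = 0) -> digit s m k <= 0.
Proof.
move=> Mm sm k0 hk; have [_ /(_ sm) [k' [k'0 hk' hj]]] := sP Mm.
have [kk'|kk'|->] := ltngtP k k'; last by rewrite ltW.
  by rewrite hj // k0.
by rewrite hk ?ltxx // in hk'; rewrite kk' andbT; case/andP: k'0.
Qed.

Lemma lex_neg1 m : (M <= m)%N -> s m != 0 ->
  s m * (s m.+1 - s m.-1) <= 0.
Proof.
move=> Mm sm; have := @lex_neg_le m 1 Mm sm isT.
rewrite /digit /= addn1 subn1 addr0; apply=> -[|j] //=; lia.
Qed.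

Lemma lex_neg2 m : (M <= m)%N -> s m != 0 -> s m.+1 = s m.-1 ->
  s m * (s m.+2 + s (m - 2)%N) + 1 <= 0.
Proof.
move=> Mm sm h; have := @lex_neg_le m 2 Mm sm isT.
rewrite /digit /= addn2; apply=> -[|[|j]] //= _.
by rewrite addn1 subn1 h subrr mulr0.
Qed.

(** A finite check: the conditions on the digits 1 and 2 at the positions m - 1 to m + 2 involve
    only the six values from s (m - 2) to s (m + 3), and every assignment with s m and s (m + 1)
    nonzero violates one of them. *)
Lemma lex_neg_no_adjacent m : (M + 2 <= m)%N -> s m != 0 -> s m.+1 = 0.
Proof.
move=> Mm sm; apply/eqP; apply: contraT => sm1.
have v k : (m.-2 <= k)%N -> [\/ s k = 0, s k = 1 | s k = -1].
  by move=> h; apply: lex_neg_val; lia.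
have e0 := @lex_neg1 m ltac:(lia) sm.
have e1 := @lex_neg1 m.+1 ltac:(lia) sm1.
have e2 := @lex_neg1 m.+2 ltac:(lia).
have em := @lex_neg1 m.-1 ltac:(lia).
have f0 := @lex_neg2 m ltac:(lia) sm.
have f1 := @lex_neg2 m.+1 ltac:(lia) sm1.
rewrite (_ : m.-1.+1 = m) in em; last lia.
rewrite (_ : m.-1.-1 = (m - 2)%N) in em; last lia.
rewrite (_ : (m.+1 - 2)%N = m.-1) /= in f1; last lia.
move: e0 e1 e2 em f0 f1 sm sm1 => /=.
have := v (m - 2)%N ltac:(lia); have := v m.-1 ltac:(lia).
have := v m ltac:(lia); have := v m.+1 ltac:(lia).
have := v m.+2 ltac:(lia); have := v m.+3 ltac:(lia).
clear; move: (s _) (s _) (s _) (s _) (s _) (s _) => a b c d e f.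
by do 6 (case=> ->); move=> // e0 e1 e2 em f0 f1 _ _;
  try move: (em isT); try move: (e2 isT); try move: (f0 erefl);
  try move: (f1 erefl).
Qed.

Lemma lex_neg_isolated m : (M + 3 <= m)%N -> s m != 0 ->
  s m.+1 = 0 /\ s m.-1 = 0.
Proof.
move=> Mm sm; split; first by apply: lex_neg_no_adjacent sm; lia.
apply/eqP; apply: contraT => sm1; have := @lex_neg_no_adjacent m.-1.
rewrite (_ : m.-1.+1 = m); last lia.
by move=> h; rewrite h ?eqxx // in sm; lia.
Qed.

(** As the digit at 1 vanishes, the digit at 2 is at most 0; because of its extra 1, a neighbour at
    distance 2 must have the opposite sign. *)
Lemma lex_neg_near m : (M + 3 <= m)%N -> s m != 0 ->
  [\/ s m.+2 = - s m /\ s (m - 2)%N = - s m,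
      s m.+2 = - s m /\ s (m - 2)%N = 0 |
      s m.+2 = 0 /\ s (m - 2)%N = - s m].
Proof.
move=> Mm sm; have [h1 h2] := lex_neg_isolated Mm sm.
have := @lex_neg2 m ltac:(lia) sm; rewrite h1 h2 => /(_ erefl).
have := @lex_neg_val m ltac:(lia); have := @lex_neg_val m.+2 ltac:(lia).
have := @lex_neg_val (m - 2) ltac:(lia); move: sm; clear.
move: (s _) (s _) (s _) => a b c.
by move=> sm; do 3 (case=> ?); subst => // h;
  first [by move: h|by constructor 1|by constructor 2|by constructor 3].
Qed.

(** Exactly one opposite neighbour at distance 2 cancels the extra 1, so the sign condition is
    passed on to the digit at [j]. *)
Lemma lex_neg_digit0 m j : (M + 3 <= m)%N -> s m != 0 ->
  s m.+2 = 0 \/ s (m - 2)%N = 0 ->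
  (forall i, (2 < i < j)%N -> s (m + i)%N = 0 /\ s (m - i)%N = 0) ->
  forall i, (0 < i < j)%N -> digit s m i = 0.
Proof.
move=> Mm sm h2 hj i /andP[i0 ij].
have [i2|i2] := ltnP 2 i.
  have [h h'] := hj i ltac:(by rewrite i2 ij).
  by rewrite /digit h h' oppr0 if_same addr0 mulr0 add0r; case: i i2 {i0 ij h h'} => [|[|[]]].
have [ha hb] := lex_neg_isolated Mm sm.
have := lex_neg_near Mm sm; have := @lex_neg_val m ltac:(lia).
case: i i0 i2 {ij} => [|[|[|i]]] // _ _ h0 h1; rewrite /digit /= ?addn1 ?subn1 ?addn2.
  by rewrite ha hb; lia.
move: sm h2 h0 h1; clear; move: (s m.+2) (s (m - 2)%N) (s m) => a b c.
move=> c0 h2 h0 h1.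
case: h1 h2 h0 c0 => [[-> ->]|[-> ->]|[-> ->]] [] h2 [] h0; rewrite h0 in h2 *; lia.
Qed.

(** * Gaps between consecutive nonzero steps: even length and alternating signs *)

Section Gap.
Variables (K k m : nat).
Hypothesis IH : forall k' m', (k' < k)%N -> (0 < k')%N ->
  (M + 3 + k' * K <= m')%N -> s m' != 0 -> s (m' + k')%N != 0 ->
  (forall i, (0 < i < k')%N -> s (m' + i)%N = 0) ->
  ~~ odd k' /\ s (m' + k')%N = - s m'.
Hypothesis kK : (k <= K)%N.
Hypothesis Mm : (M + 3 + k * K <= m)%N.

(** Room for the induction: applying [IH] to a gap of length i - 2 moves back by at most i <= K
    positions, and the margin k * K holds K positions for each unit of gap length. *)
Lemma gap_location i : (1 < i <= k)%N -> (M + 3 + (i - 2) * K + i <= m)%N.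
Proof.
move=> ik; have : ((i - 1) * K <= k * K)%N by rewrite leq_mul2r; lia.
rewrite (_ : (i - 1 = (i - 2) + 1)%N); last lia.
by rewrite mulnDl; lia.
Qed.

(** The right neighbour at distance 2 being 0, s (m - 2) is - s m. The nearest nonzero s (m - i)
    would be separated from it by a gap shorter than k, hence even and sign-changing by [IH]. Then i
    is even, s (m - i) = s m, and the first nonzero digit at m would be positive. *)
Lemma lex_neg_zero_left : s m != 0 ->
  (forall i, (0 < i < k)%N -> s (m + i)%N = 0) ->
  forall i, (2 < i < k)%N -> s (m - i)%N = 0.
Proof.
move=> sm sk; elim/ltn_ind => i IHi /andP[i2 ik].
have s2 : s m.+2 = 0 by rewrite -addn2; apply: sk; lia.
have [[h _]|[h _]|[_ h]] := lex_neg_near (ltac:(lia) : (M + 3 <= m)%N) sm.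
- by move: sm; rewrite -oppr_eq0 -h s2.
- by move: sm; rewrite -oppr_eq0 -h s2.
apply/eqP; apply: contraT => si.
have loc := @gap_location i ltac:(lia).
have im : (i <= m)%N by apply: leq_trans loc; rewrite leq_addl.
have [||||||ev e] := @IH (i - 2) (m - i).
- by lia.
- by lia.
- by lia.
- exact: si.
- by rewrite (_ : (m - i + (i - 2) = m - 2)%N) ?h ?oppr_eq0 //; lia.
- move=> l li; rewrite (_ : (m - i + l = m - (i - l))%N); last lia.
  by apply: IHi; lia.
rewrite (_ : (m - i + (i - 2) = m - 2)%N) in e; last lia.
have := @lex_neg_le m i ltac:(lia) sm ltac:(lia).
have dz := @lex_neg_digit0 m i ltac:(lia) sm (or_introl s2).
move=> /(_ (dz _)); rewrite /digit sk; last by rewrite (ltnW (ltnW i2)).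
have -> : odd i = false by move: ev i2; clear; lia.
rewrite -[s (m - i)%N]opprK -e h opprK (_ : (i == 2%N) = false); last lia.
rewrite add0r addr0 => hh.
have : s m * s m <= 0.
  apply: hh => l li; split; first by apply: sk; lia.
  by apply: IHi; lia.
by have := @lex_neg_val m ltac:(lia); move: sm; clear; case=> ?; lia.
Qed.

Lemma lex_neg_zero_right : s (m + k)%N != 0 ->
  (forall i, (0 < i < k)%N -> s (m + i)%N = 0) ->
  forall i, (2 < i < k)%N -> s (m + k + i)%N = 0.
Proof.
move=> sm sk; elim/ltn_ind => i IHi /andP[i2 ik].
have s2 : s (m + k - 2)%N = 0.
  by rewrite (_ : (m + k - 2 = m + (k - 2))%N); [apply: sk; lia|lia].
have [[_ h]|[h _]|[_ h]] := lex_neg_near (ltac:(lia) : (M + 3 <= m + k)%N) sm.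
- by move: sm; rewrite -oppr_eq0 -h s2.
- apply/eqP; apply: contraT => si.
  have loc := @gap_location i ltac:(lia).
  have im : (i <= m)%N by apply: leq_trans loc; rewrite leq_addl.
  have [||||||ev e] := @IH (i - 2) (m + k).+2.
  + by lia.
  + by lia.
  + by lia.
  + by rewrite h oppr_eq0.
  + by rewrite (_ : ((m + k).+2 + (i - 2) = m + k + i)%N) //; lia.
  + move=> l li; rewrite (_ : ((m + k).+2 + l = m + k + (l + 2))%N); last lia.
    by apply: IHi; lia.
  rewrite (_ : ((m + k).+2 + (i - 2) = m + k + i)%N) in e; last lia.
  have := @lex_neg_le (m + k) i ltac:(lia) sm ltac:(lia).
  have dz := @lex_neg_digit0 (m + k) i ltac:(lia) sm (or_intror s2).
  move=> /(_ (dz _)); rewrite /digit e h opprK.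
  rewrite (_ : (m + k - i = m + (k - i))%N); last lia.
  rewrite (sk (k - i)%N); last lia.
  have -> : odd i = false by move: ev i2; clear; lia.
  rewrite (_ : (i == 2%N) = false); last lia.
  rewrite !addr0 => hh.
  have : s (m + k)%N * s (m + k)%N <= 0.
    apply: hh => l li; split; first by apply: IHi; lia.
    rewrite (_ : (m + k - l = m + (k - l))%N); last lia.
    by apply: sk; lia.
  by have := @lex_neg_val (m + k) ltac:(lia); move: sm; clear; case=> ?; lia.
- by move: sm; rewrite -oppr_eq0 -h s2.
Qed.

(* A gap of odd length, or between equal signs, cannot be balanced by the
   neighbouring gaps, which are at least as long as [k - 2] and, if shorter than
   [k], already known to be even and sign-changing. *)
Lemma lex_neg_gap_step : (0 < k)%N -> s m != 0 -> s (m + k)%N != 0 ->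
  (forall i, (0 < i < k)%N -> s (m + i)%N = 0) ->
  ~~ odd k /\ s (m + k)%N = - s m.
Proof.
move=> k0 sm smk sk.
have [h1 h2] := lex_neg_isolated (ltac:(lia) : (M + 3 <= m)%N) sm.
have nm := lex_neg_near (ltac:(lia) : (M + 3 <= m)%N) sm.
have nk := lex_neg_near (ltac:(lia) : (M + 3 <= m + k)%N) smk.
have [k2|k2] := ltnP 2 k; last first.
  have [kE|kE] : k = 1%N \/ k = 2%N by lia.
    by rewrite kE addn1 h1 eqxx in smk.
  rewrite kE addn2 in smk *; move: nm smk; clear.
  by case=> [[-> _]|[-> _]|[-> _]] //; rewrite eqxx.
have zl := lex_neg_zero_left sm sk.
have zr := lex_neg_zero_right smk sk.
have s2 : s m.+2 = 0 by rewrite -addn2; apply: sk; lia.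
have s2' : s (m + k - 2)%N = 0.
  by rewrite (_ : (m + k - 2 = m + (k - 2))%N); [apply: sk; lia|lia].
have loc := @gap_location k ltac:(lia).
have im : (k <= m)%N by apply: leq_trans loc; rewrite leq_addl.
have hl : s (m - 2)%N = - s m.
  case: nm => [[h _]|[h _]|[_ //]]; by move: sm; rewrite -oppr_eq0 -h s2.
have hr : s (m + k).+2 = - s (m + k)%N.
  case: nk => [[//]|[//]|[_ h]]; by move: smk; rewrite -oppr_eq0 -h s2'.
have v0 := @lex_neg_val m ltac:(lia).
have v1 := @lex_neg_val (m + k) ltac:(lia).
have dl : digit s m k <= 0.
  apply: lex_neg_le => //; first lia.
  apply: lex_neg_digit0 => //; [lia|by left|].
  by move=> i ik; split; [apply: sk; lia|exact: zl].
have dr : digit s (m + k) k <= 0.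
  apply: lex_neg_le => //; first lia.
  apply: lex_neg_digit0 => //; [lia|by right|].
  move=> i ik; split; first exact: zr.
  by rewrite (_ : (m + k - i = m + (k - i))%N); [apply: sk; lia|lia].
rewrite /digit (_ : (k == 2%N) = false) in dl; last lia.
rewrite /digit (_ : (k == 2%N) = false) in dr; last lia.
rewrite addnK in dr.
have [sl|sl] := eqVneq (s (m - k)%N) 0; last first.
  have [||||||ev e] := @IH (k - 2) (m - k).
  - by lia.
  - by lia.
  - by lia.
  - exact: sl.
  - by rewrite (_ : (m - k + (k - 2) = m - 2)%N) ?hl ?oppr_eq0 //; lia.
  - move=> l li; rewrite (_ : (m - k + l = m - (k - l))%N); last lia.
    by apply: zl; lia.
  rewrite (_ : (m - k + (k - 2) = m - 2)%N) in e; last lia.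
  have ek : ~~ odd k by move: ev k2; clear; lia.
  split=> //; rewrite (negbTE ek) -[s (m - k)%N]opprK -e hl opprK in dl.
  move: dl sm smk v0 v1; clear; move: (s _) (s _) => a b.
  by move=> dl a0 b0; do 2 (case=> ?); subst.
rewrite sl oppr0 if_same addr0 in dl.
have sE : s (m + k)%N = - s m.
  move: dl sm smk v0 v1; clear; move: (s _) (s _) => a b.
  by move=> dl a0 b0; do 2 (case=> ?); subst.
split=> //.
have [sr|sr] := eqVneq (s (m + k + k)%N) 0.
  move: dr; rewrite sr sE; case: (odd k) => //.
  by move: sm v0; clear; move: (s _) => a a0; case=> ?; subst.
have [||||||ev _] := @IH (k - 2) (m + k).+2.
- by lia.
- by lia.
- by lia.
- by rewrite hr oppr_eq0.
- by rewrite (_ : ((m + k).+2 + (k - 2) = m + k + k)%N) //; lia.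
- move=> l li; rewrite (_ : ((m + k).+2 + l = m + k + (l + 2))%N); last lia.
  by apply: zr; lia.
by move: ev k2; clear; lia.
Qed.
End Gap.

Lemma lex_neg_gap K k m : (k <= K)%N -> (0 < k)%N ->
  (M + 3 + k * K <= m)%N -> s m != 0 -> s (m + k)%N != 0 ->
  (forall i, (0 < i < k)%N -> s (m + i)%N = 0) ->
  ~~ odd k /\ s (m + k)%N = - s m.
Proof.
elim/ltn_ind: k m => k IH m kK k0 Mm; apply: (lex_neg_gap_step (K := K)) => //.
by move=> k' m' k'k k'0 Mm'; apply: IH => //; lia.
Qed.

(** If s vanished at the next N positions, [lex_neg_zero_left] would make all digits from 1 to N
    vanish at m, although one of them is negative. *)
Lemma lex_neg_gap_bounded m : (M + 3 + N.+1 * N.+1 <= m)%N -> s m != 0 ->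
  exists k, [/\ (0 < k <= N)%N, ~~ odd k, s (m + k)%N = - s m &
                forall i, (0 < i < k)%N -> s (m + i)%N = 0].
Proof.
move=> Mm sm.
have [/existsP[i0 /andP[i00 si0]]|/existsPn nz] :=
  boolP [exists i : 'I_N.+1, (0 < i)%N && (s (m + i)%N != 0)]; last first.
  have sk i : (0 < i < N.+1)%N -> s (m + i)%N = 0.
    move=> /andP[i0 iN]; have := nz (Ordinal iN); rewrite i0 /=.
    by rewrite negbK => /eqP.
  have zl := @lex_neg_zero_left N.+1 N.+1 m
    ltac:(by move=> ????; apply: lex_neg_gap => //; lia) (leqnn _) Mm sm sk.
  have [_ /(_ sm) [k [kN hk hj]]] := sP (ltac:(lia) : (M <= m)%N).
  suff dz : digit s m k = 0 by rewrite dz ltxx in hk.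
  have N1 : (1 < N)%N.
    have [//|N1] := ltnP 1 N; have kE : k = 1%N by lia.
    have [h1 h2] := lex_neg_isolated (ltac:(lia) : (M + 3 <= m)%N) sm.
    by move: hk; rewrite kE /digit addn1 subn1 h1 h2 /= oppr0 mulr0.
  apply: (@lex_neg_digit0 m N.+1) => //; [lia| |move=> i ik].
    by left; rewrite -addn2; apply: sk; lia.
  by split; [apply: sk; lia|exact: zl].
pose P i := (0 < i)%N && (s (m + i)%N != 0).
have P0 : P i0 by rewrite /P i00 si0.
have [k /andP[k0 sk] kmin] := @ex_minnP P (ex_intro (fun i => is_true (P i)) _ P0).
have ki := kmin _ P0.
have kN : (k <= N.+1)%N by have := ltn_ord i0; lia.
have kz i : (0 < i < k)%N -> s (m + i)%N = 0.
  move=> /andP[i1 ik]; apply/eqP; apply: contraT => si.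
  by have := kmin i; rewrite /P i1 si leqNgt ik; apply.
have [|ek sE] := @lex_neg_gap N.+1 k m kN k0 _ sm sk kz.
  have : (k * N.+1 <= N.+1 * N.+1)%N by rewrite leq_mul2r kN orbT.
  by move: Mm; clear; lia.
exists k; split=> //; rewrite k0 /=; have := ltn_ord i0; lia.
Qed.

End LexNeg.

(** * The binary word read off the steps *)

Section Word.
Variables (s : nat -> int) (m0 : nat).

(** As signs alternate, the partial sums of s along the parity class of m0 take two values only. The
    current one is given by the sign of the last nonzero step up to m0 + 2t. *)
Fixpoint word_of (t : nat) : bool :=
  if t is t'.+1 then
    if s (m0 + t'.*2.+2)%N == 0 then word_of t' else s (m0 + t'.*2.+2)%N == 1
  else s m0 == 1.

Variables (M N : nat).
Hypothesis sP : lex_neg s M N.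
Hypothesis Mm0 : (M + 3 + N.+1 * N.+1 <= m0)%N.
Hypothesis sm0 : s m0 != 0.

Lemma word_of_last t : exists l,
  [/\ (l <= t)%N, s (m0 + l.*2)%N != 0, word_of t = (s (m0 + l.*2)%N == 1) &
      forall i, (l.*2 < i <= t.*2)%N -> s (m0 + i)%N = 0].
Proof.
elim: t => [|t [l [lt sl vl zl]]].
  by exists 0%N; split=> // [||i]; rewrite ?addn0 //; lia.
have [k [k0 ek sk zk]] := @lex_neg_gap_bounded _ _ _ sP (m0 + l.*2) ltac:(lia) sl.
have kt : (t.*2 < l.*2 + k)%N.
  rewrite ltnNge; apply/negP => h.
  by move: sl; rewrite -oppr_eq0 -sk -addnA zl ?eqxx //; lia.
have [kE|kE] := eqVneq (l.*2 + k)%N t.*2.+2.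
  exists t.+1; rewrite doubleS; split=> // [||i it].
  - by rewrite -kE addnA sk oppr_eq0.
  - by rewrite /= -kE addnA sk oppr_eq0 (negbTE sl).
  - by lia.
have k2 : (t.*2.+2 < l.*2 + k)%N by move: ek kE kt; clear; lia.
exists l; split=> //; first by lia.
  rewrite /= ifT //; apply/eqP.
  have := zk (t.*2.+2 - l.*2)%N ltac:(lia).
  by rewrite (_ : (m0 + l.*2 + (t.*2.+2 - l.*2) = m0 + t.*2.+2)%N) //; lia.
move=> i it; have := zk (i - l.*2)%N ltac:(lia).
by rewrite (_ : (m0 + l.*2 + (i - l.*2) = m0 + i)%N) //; lia.
Qed.

Lemma word_ofP t : s (m0 + t.*2.+1)%N = 0 /\
  s (m0 + t.*2.+2)%N = (word_of t.+1)%:Z - (word_of t)%:Z.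
Proof.
have [l [lt sl vl zl]] := word_of_last t.
have [k [k0 ek sk zk]] := @lex_neg_gap_bounded _ _ _ sP (m0 + l.*2) ltac:(lia) sl.
have kt : (t.*2 < l.*2 + k)%N.
  rewrite ltnNge; apply/negP => h.
  by move: sl; rewrite -oppr_eq0 -sk -addnA zl ?eqxx //; lia.
have kt1 : (t.*2.+1 < l.*2 + k)%N by move: ek kt; clear; lia.
split.
  have := zk (t.*2.+1 - l.*2)%N ltac:(lia).
  by rewrite (_ : (m0 + l.*2 + (t.*2.+1 - l.*2) = m0 + t.*2.+1)%N) //; lia.
rewrite /= vl; have [s0|s0] := eqVneq; first by rewrite s0 subrr.
have kE : (l.*2 + k)%N = t.*2.+2.
  apply/eqP; apply: contraT => kE.
  have := zk (t.*2.+2 - l.*2)%N ltac:(lia).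
  rewrite (_ : (m0 + l.*2 + (t.*2.+2 - l.*2) = m0 + t.*2.+2)%N); last lia.
  by move=> h; rewrite h eqxx in s0.
rewrite -kE addnA sk; move: sl.
by have [] := @lex_neg_val _ _ _ sP (m0 + l.*2) ltac:(lia) => ->.
Qed.

(** Odd digits vanish, and the even digit at 2i is the difference of s m * D i and s m * D (i - 1),
    where D compares the two halves of the word. The extra 1 at i = 1 cancels - s m * D 0 = -1.
    Hence the digits vanish as long as D does, and the first negative one marks the first
    difference. *)
Lemma word_of_markoff : markoff word_of N N.
Proof.
move=> j Nj vj; set m := (m0 + j.*2.+2)%N; set v := word_of in vj *.
pose D i : int := (v (j.+1 + i)%N)%:Z - (v (j - i)%N)%:Z.
have sm : s m = D 0%N by rewrite /m (word_ofP j).2 /D addn0 subn0.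
have sm0' : s m != 0.
  by move: vj; rewrite sm /D addn0 subn0; case: (v j) (v j.+1) => [] [].
have smm : s m * s m = 1.
  by move: vj; rewrite sm /D addn0 subn0; case: (v j) (v j.+1) => [] [].
have [_ /(_ sm0') [k [k0 hk hj]]] := sP (ltac:(rewrite /m; lia) : (M <= m)%N).
have dodd i : (i <= N)%N -> odd i -> digit s m i = 0.
  move=> iN oi; rewrite /digit oi (_ : (i == 2%N) = false); last lia.
  rewrite (_ : (m + i = m0 + (j + i./2).*2.+3)%N); last by rewrite /m; lia.
  rewrite (_ : (m - i = m0 + (j - i./2).*2.+1)%N); last by rewrite /m; lia.
  by rewrite -doubleS !(word_ofP _).1 oppr0 !addr0 mulr0.
have deven i : (0 < i)%N -> (i.*2 <= N)%N ->
    digit s m i.*2 = s m * D i - s m * D i.-1 + (i == 1%N)%:Z.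
  move=> i0 iN; rewrite /digit odd_double.
  rewrite (_ : (m + i.*2 = m0 + (j + i).*2.+2)%N); last by rewrite /m; lia.
  rewrite (_ : (m - i.*2 = m0 + (j - i).*2.+2)%N); last by rewrite /m; lia.
  rewrite !(word_ofP _).2 -/v -mulrBr /D; congr (_ * _ + _%:Z); last first.
    by have -> : (i.*2 == 2%N) = (i == 1%N) by lia.
  have -> : (j.+1 + i = (j + i).+1)%N by [].
  have -> : (j.+1 + i.-1 = j + i)%N by lia.
  have -> : (j - i.-1 = (j - i).+1)%N by lia.
  by lia.
have ok : ~~ odd k.
  by apply/negP => ok; rewrite dodd // ?ltxx // in hk; case/andP: k0.
have kE : k = k./2.*2 by rewrite even_halfK.
set h := k./2 in kE.
have Dz i : (0 < i < h)%N -> s m * D i = 0.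
  elim: i => // -[|i] IHi ih.
    have := hj 2%N ltac:(lia); rewrite -[2%N]/(1%N.*2) deven //; last lia.
    by rewrite /= -sm smm; lia.
  have := hj i.+2.*2 ltac:(lia); rewrite deven //; last lia.
  by rewrite /= IHi ?subr0 ?addr0 //; lia.
have Dh : s m * D h < 0.
  have := hk; rewrite kE deven; [|lia|lia].
  have [h1|h1] := eqVneq h 1%N; first by rewrite h1 /= -sm smm; lia.
  by rewrite (Dz h.-1) ?subr0 ?(negbTE h1) ?addr0 //; lia.
exists h; split.
- by lia.
- move=> i /Dz /eqP; rewrite mulf_eq0 (negbTE sm0') orFb.
  by rewrite /D; move: (v _) (v _) => [] []; lia.
- move: Dh vj; rewrite sm /D addn0 subn0.
  by move: (v _) (v _) (v _) (v _); clear; do 4 case; lia.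
- move: Dh vj; rewrite sm /D addn0 subn0.
  by move: (v _) (v _) (v _) (v _); clear; do 4 case; lia.
Qed.
End Word.

(** * Distances, upper limits and digit expansions *)

Section Distance.
Variable R : realType.
Implicit Types (z : R) (k : int).

Lemma dist_int_has_lbound z : has_lbound [set `|z - k%:~R| | k in [set: int]].
Proof. by exists 0 => _ [k _ <-]. Qed.

Lemma dist_int_le z k : dist_int z <= `|z - k%:~R|.
Proof. by apply: ge_inf; [exact: dist_int_has_lbound|exists k]. Qed.

Lemma dist_int_ge0 z : 0 <= dist_int z.
Proof.
by apply: lb_le_inf => [|_ [k _ <-] //]; exists `|z - 0%:~R|, 0.
Qed.

Lemma dist_int_small z k : `|z - k%:~R| <= 2^-1 -> dist_int z = `|z - k%:~R|.
Proof.
move=> zk; apply/eqP; rewrite eq_le dist_int_le /=.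
apply: lb_le_inf => [|_ [j _ <-]]; first by exists `|z - 0%:~R|, 0.
have [->//|jk] := eqVneq j k.
have h : 1 <= `|k%:~R - j%:~R : R|.
  by rewrite -intrB -intr_norm (ler_int R 1) -gtz0_ge1 normr_gt0 subr_eq0 eq_sym.
have := ler_distD z (k%:~R : R) j%:~R; rewrite (distrC k%:~R z); lra.
Qed.

Lemma near_int z : exists k, `|z - k%:~R| <= 2^-1.
Proof.
exists (Num.floor (z + 2^-1)).
have /andP[] := floor_itv (z + 2^-1); rewrite intrD => h1 h2.
by rewrite ler_norml; apply/andP; split; lra.
Qed.

Lemma dist_int_le_half z : dist_int z <= 2^-1.
Proof. by have [k zk] := near_int z; rewrite (dist_int_small zk). Qed.

End Distance.

Section Limsup.
Variable R : realType.
Implicit Types (u : nat -> R) (l : R).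

(** A relation rather than a function, so that a value can be certified on a shifted or eventually
    equal sequence and identified with [limn_sup] afterwards. *)
Definition is_limsup u l : Prop :=
  (forall e : R, 0 < e -> exists M, forall m, (M <= m)%N -> u m <= l + e) /\
  (forall (e : R) M, 0 < e -> exists2 m, (M <= m)%N & l - e <= u m).

Lemma is_limsup_unique u l l' : is_limsup u l -> is_limsup u l' -> l = l'.
Proof.
move=> [h1 h2] [h1' h2']; apply/eqP; rewrite eq_le; apply/andP; split;
  apply/ler_addgt0Pl => e e0.
  have e2 : 0 < e / 2 by lra.
  have [M hM] := h1' _ e2.
  by have [m /hM] := h2 (e / 2) M e2; lra.
have e2 : 0 < e / 2 by lra.
have [M hM] := h1 _ e2.
by have [m /hM] := h2' (e / 2) M e2; lra.
Qed.

Lemma limn_sup_is_limsup u a b : (forall m, a <= u m <= b) ->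
  is_limsup u (limn_sup u).
Proof.
move=> uab.
have ub : has_ubound (range u) by exists b => _ [m _ <-]; case/andP: (uab m).
have lb : has_lbound (range u) by exists a => _ [m _ <-]; case/andP: (uab m).
have -> : limn_sup u = inf (range (sups u)).
  by apply/cvg_lim => //; exact: cvg_sups_inf.
have usup n m : (n <= m)%N -> u m <= sups u n.
  by move=> nm; apply: ub_le_sup; [exact: has_ubound_sdrop|exists m].
have lbs : has_lbound (range (sups u)).
  exists a => _ [n _ <-]; apply: le_trans (usup n n (leqnn n)).
  by case/andP: (uab n).
split=> [e e0|e M e0].
  have [|_ [n _ <-] h] := inf_adherent e0 (E := range (sups u)).
    by split=> //; exists (sups u 0), 0%N.
  by exists n => m /usup h'; exact: le_trans h' (ltW h).
have : inf (range (sups u)) <= sups u M by apply: ge_inf => //; exists M.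
have [|_ [m Mm <-] h] := sup_adherent e0 (E := sdrop u M).
  by split; [exists (u M), M => /=|exact: has_ubound_sdrop].
move=> h'; exists m => //; apply: le_trans (ltW h).
by rewrite lerD2r.
Qed.

Lemma limsup_dist_is_limsup (a xi : R) :
  is_limsup (fun m => dist_int (xi * a ^+ m)) (limsup_dist a xi).
Proof.
apply: (@limn_sup_is_limsup _ 0 2^-1) => m.
by rewrite dist_int_ge0 dist_int_le_half.
Qed.

Lemma is_limsup_shift u l m0 :
  is_limsup (fun m => u (m0 + m)%N) l -> is_limsup u l.
Proof.
move=> [h1 h2]; split=> [e /h1[M hM]|e M /(h2 _ M)[m Mm h]].
  exists (m0 + M)%N => m Mm; have := hM (m - m0)%N ltac:(lia).
  by rewrite subnKC //; lia.
by exists (m0 + m)%N => //; lia.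
Qed.

End Limsup.

(** * Sign of a power series in x with small integer digits *)

Section Lex.
Variables (R : realType) (x : R).
Hypothesis x0 : 0 < x.
Hypothesis x3 : x < 3^-1.

(** The extreme sum -2 / (1 - x) exceeds -3 exactly because x < 1/3. *)
Lemma digit_sum_gt (e : nat -> int) n : (forall j, -2 <= e j) ->
  - 3 < \sum_(j < n) x ^+ j * (e j)%:~R.
Proof.
have key (r S : R) : -2 <= r -> -3 < S -> -3 < r + x * S.
  move: x3 => x3' h1 h2; have : 0 < x * (S + 3) by apply: mulr_gt0 => //; lra.
  by lra.
elim: n e => [|n IH] e he; first by rewrite big_ord0 oppr_lt0 ltr0n.
rewrite big_ord_recl /= expr0 mul1r.
under eq_bigr => i _ do rewrite /bump /= add1n exprS -mulrA.
rewrite -mulr_sumr; apply: key; first by rewrite (ler_int R (-2)).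
exact: (IH (fun j => e j.+1) (fun j => he j.+1)).
Qed.

(** A leading digit of at least 1 outweighs everything after it, which is more than -3x > -1. *)
Lemma digit_sum_neg (e : nat -> int) n : (forall j, -2 <= e j) ->
  \sum_(j < n) x ^+ j * (e j)%:~R < 0 ->
  exists k, [/\ (k < n)%N, e k < 0 & forall j, (j < k)%N -> e j = 0].
Proof.
have key (r S : R) : 1 <= r -> -3 < S -> r + x * S < 0 -> False.
  move: x3 => x3' h1 h2; have : 0 < x * (S + 3) by apply: mulr_gt0 => //; lra.
  by lra.
elim: n e => [|n IH] e he; first by rewrite big_ord0 ltxx.
rewrite big_ord_recl /= expr0 mul1r.
under eq_bigr => i _ do rewrite /bump /= add1n exprS -mulrA.
rewrite -mulr_sumr; have := @digit_sum_gt (fun j => e j.+1) n (fun j => he j.+1).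
have := IH (fun j => e j.+1) (fun j => he j.+1).
rewrite /=; move: (\sum_(j < n) _) => S IH' h1 h2.
have [e0|e0|e0] := ltrgtP (e 0%N) 0.
- by exists 0%N; split.
- by case: (key _ _ _ h1 h2); rewrite (ler_int R 1) -gtz0_ge1.
rewrite e0 add0r pmulr_rlt0 // in h2.
have [k [kn ek ej]] := IH' h2; exists k.+1; split=> // -[|j] //.
by rewrite ltnS => /ej.
Qed.

End Lex.

(** * Orbits of the recurrence *)

Definition window (s : nat -> int) (m j : nat) : int :=
  s (m + j)%N + (if odd j then - s (m - j)%N else s (m - j)%N).

Lemma sum_pairs (V : nmodType) (F : nat -> V) T :
  \sum_(i < T.*2) F i = \sum_(i < T) (F i.*2 + F i.*2.+1).
Proof.
elim: T => [|T IH]; first by rewrite !big_ord0.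
by rewrite doubleS !big_ord_recr /= IH addrA.
Qed.

Lemma geometric_sum_le (R : realType) (y C : R) (d : nat -> R) T :
  0 <= y < 1 -> (forall i, `|d i| <= C) ->
  `|\sum_(i < T) y ^+ i * d i| <= C / (1 - y).
Proof.
move=> /andP[y0 y1] dC.
have C0 : 0 <= C := le_trans (normr_ge0 _) (dC 0%N).
elim: T d dC => [|T IH] d dC.
  by rewrite big_ord0 normr0 divr_ge0 // subr_ge0 ltW.
rewrite big_ord_recl /= expr0 mul1r.
under eq_bigr => i _ do rewrite /bump /= add1n exprS -mulrA.
rewrite -mulr_sumr; apply: le_trans (ler_normD _ _) _.
have -> : C / (1 - y) = C + y * (C / (1 - y)) by field; lra.
rewrite lerD // normrM ger0_norm // ler_wpM2l //.
exact: (IH (fun i => d i.+1)).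
Qed.

Lemma expr_small (R : realType) (y e : R) : 0 <= y < 1 -> 0 < e ->
  exists N, forall T, (N <= T)%N -> y ^+ T <= e.
Proof.
move=> /andP[y0 y1] e0.
have := @cvg_expr R y; rewrite ger0_norm // => /(_ y1) /cvgrPdist_le /(_ _ e0).
move=> [N _ h]; exists N => T NT; have := h T NT.
by rewrite sub0r normrN ger0_norm // exprn_ge0.
Qed.

Section Dynamics.
Variables (R : realType) (a : R) (b : int).
Hypothesis a3 : 3 < a.
Hypothesis ab : a ^+ 2 = b%:~R * a + 1.
Local Notation x := (a^-1).

Lemma inv_facts : [/\ 0 < a, 0 < x, x < 3^-1, a * x = 1 & b%:~R = a - x].
Proof.
have h := a3; have a0 : 0 < a by lra.
have an0 : a != 0 by rewrite gt_eqF.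
split=> //; first by rewrite invr_gt0.
- by rewrite ltf_pV2 // posrE ltr0n.
- by rewrite divff.
- apply: (mulIf an0); rewrite mulrBl mulVf //.
  by apply: (addIr 1); rewrite -ab expr2 subrK.
Qed.

Section Orbit.
Variables (eps : nat -> R) (s : nat -> int) (C : R).
Hypothesis epsS : forall m, eps m.+2 = b%:~R * eps m.+1 + eps m - (s m)%:~R.
Hypothesis epsC : forall m, `|eps m| <= C.

(* The characteristic polynomial is (X - a)(X + 1/a): the combinations
   [eps m.+1 + eps m / a] and [eps m.+1 - a * eps m] satisfy first-order
   recurrences, one contracting forwards and the other backwards. *)
Lemma orbit_forward m : eps m.+1 + x * eps m =
  x * ((s m)%:~R + (eps m.+2 + x * eps m.+1)).
Proof.
have [_ _ _ ax bE] := inv_facts; rewrite epsS bE; ring: ax.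
Qed.

Lemma orbit_backward m : eps m.+2 - a * eps m.+1 =
  - (s m)%:~R - x * (eps m.+1 - a * eps m).
Proof.
have [_ _ _ ax bE] := inv_facts; rewrite epsS bE; ring: ax.
Qed.

(** For N = 0 the centre splits into [s m], a forward and a backward combination. Each further step
    unfolds one term on both sides, with a factor x to the right and - x to the left. *)
Lemma orbit_center N m : (N <= m)%N -> (a + x) * eps m.+1 =
  (s m)%:~R + \sum_(j < N) x ^+ j.+1 * (window s m j.+1)%:~R
  + (x ^+ N * (eps (m + N).+2 + x * eps (m + N).+1)
     - (- x) ^+ N.+1 * (eps (m - N).+1 - a * eps (m - N)%N)).
Proof.
elim: N => [|N IH] Nm.
  rewrite big_ord0 addn0 subn0 addr0 expr0 expr1.
  have [_ _ _ ax bE] := inv_facts; rewrite epsS bE; ring: ax.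
rewrite IH; last by lia.
rewrite big_ord_recr /= -!addrA; congr (_ + (_ + _)).
have f1 := orbit_forward (m + N).+1; rewrite f1.
have f2 := orbit_backward (m - N.+1)%N.
have e1 : ((m - N.+1).+1 = m - N)%N by lia.
rewrite e1 in f2; rewrite f2 /window addnS e1.
have -> : x ^+ N.+1 * (s (m + N).+1 + (if odd N.+1 then - s (m - N.+1)%N
    else s (m - N.+1)%N))%:~R =
  x ^+ N.+1 * (s (m + N).+1)%:~R + (- x) ^+ N.+1 * (s (m - N.+1)%N)%:~R :> R.
  rewrite intrD mulrDr; congr (_ + _).
  by rewrite exprNn -signr_odd; case: (odd _); rewrite ?intrN; ring.
rewrite !exprS; ring.
Qed.

Lemma orbit_center_le N m : (N <= m)%N ->
  `|(a + x) * eps m.+1 -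
    ((s m)%:~R + \sum_(j < N) x ^+ j.+1 * (window s m j.+1)%:~R)|
  <= 3 * C * x ^+ N.
Proof.
move=> Nm; rewrite (orbit_center Nm) addrC addKr.
have [a0 x0 x1 ax _] := inv_facts; have h3 := a3.
have C0 : 0 <= C := le_trans (normr_ge0 _) (epsC 0%N).
apply: le_trans (ler_normB _ _) _.
rewrite !normrM !normrX normrN (gtr0_norm x0).
have b1 : `|eps (m + N).+2 + x * eps (m + N).+1| <= C + x * C.
  apply: le_trans (ler_normD _ _) _; rewrite lerD // normrM (gtr0_norm x0).
  by rewrite ler_pM2l.
have b2 : `|eps (m - N).+1 - a * eps (m - N)%N| <= C + a * C.
  apply: le_trans (ler_normB _ _) _; rewrite lerD // normrM (gtr0_norm a0).
  by rewrite ler_pM2l.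
(* The remainder is at most x ^+ N times (1 + x) C + x (1 + a) C = (2 + 2 x) C, which is below 3 C
   since x < 1/3. *)
have xN : 0 <= x ^+ N by rewrite exprn_ge0 // ltW.
move: b1 b2; set A := `|_ + _|; set B := `|_ - _| => b1 b2.
have -> : x ^+ N * A + x ^+ N.+1 * B = x ^+ N * (A + x * B).
  by rewrite exprSr; ring.
rewrite [leRHS]mulrC ler_wpM2l //.
have : x * B <= x * (C + a * C).
  by rewrite ler_pM2l.
have -> : x * (C + a * C) = x * C + C by ring: ax.
have : x * C <= 3^-1 * C by rewrite ler_wpM2r // ltW.
lra.
Qed.

Lemma orbit_lex_neg (d : R) M0 : 0 < d ->
  (forall m, (M0 <= m)%N -> (a + x) * `|eps m| <= 1 - x ^+ 2 - d) ->
  exists M N, lex_neg s M N.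
Proof.
move=> d0 hd; have [a0 x0 x1 ax bE] := inv_facts; have h3 := a3.
have C0 : 0 <= C := le_trans (normr_ge0 _) (epsC 0%N).
have s1 m : (M0 <= m)%N -> `|s m| <= 1.
  move=> Mm; rewrite -ltzD1 -[1 + 1]/(2%:Z) -(ltr_int R) intr_norm.
  have -> : (s m)%:~R = b%:~R * eps m.+1 + eps m - eps m.+2 by rewrite epsS; ring.
  have e0 := hd m Mm; have e1 := hd m.+1 ltac:(lia).
  have e2 := hd m.+2 ltac:(lia).
  have ax0 : 0 < a + x by lra.
  (* With b = a - x and (a + x) |eps| at most 1 at three consecutive indices, (a + x) |s m| <= a - x
     + 2 < 2 (a + x), as a > 3. *)
  rewrite -(ltr_pM2l ax0); apply: le_lt_trans (_ : _ <= (a - x + 2) * 1) _.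
    have := ler_normB (b%:~R * eps m.+1 + eps m) (eps m.+2).
    have := ler_normD (b%:~R * eps m.+1) (eps m).
    rewrite normrM bE (@ger0_norm _ (a - x)); last lra.
    move: e0 e1 e2; set u0 := `|eps m|; set u1 := `|eps m.+1|.
    set u2 := `|eps m.+2|; set w1 := `|_ + _|; set w2 := `|_ - _| => e0 e1 e2 h1 h2.
    have w : w2 <= (a - x) * u1 + u0 + u2 by lra.
    have : (a + x) * w2 <= (a + x) * ((a - x) * u1 + u0 + u2).
      by rewrite ler_pM2l.
    have : (a - x) * ((a + x) * u1) <= (a - x) * 1.
      by rewrite ler_wpM2l //; [lra|have := sqr_ge0 x; lra].
    have := sqr_ge0 x; lra.
  lra.
(* This makes the truncation error 3 C x ^+ N smaller than d, even if C = 0. Adding 2 keeps the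
   digit at 2, with its extra 1, inside the sum. *)
have [N0 hN0] := @expr_small R x (d / (6 * C + 1))
  ltac:(by apply/andP; split; lra) ltac:(by apply: divr_gt0; lra).
pose N := (N0 + 2)%N; exists (M0 + N)%N, N => m Mm.
split=> [|sm]; first by apply: s1; lia.
have s2 : s m = 1 \/ s m = -1 by have := s1 m ltac:(lia); move: sm; lia.
pose e j := if (j < N)%N then digit s m j.+1 else 0.
have eN j : (j < N)%N -> e j = digit s m j.+1 by rewrite /e => ->.
have e_ge j : -2 <= e j.
  rewrite /e; case: ifP => // jN; rewrite /digit.
  have := s1 (m + j.+1)%N ltac:(lia); have := s1 (m - j.+1)%N ltac:(lia).
  by case: s2 => ->; case: (odd _); case: (_ == _); lia.
have [|k [kN ek ej]] := @digit_sum_neg R x x0 x1 e N e_ge; last first.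
  exists k.+1; rewrite -eN //; split=> // -[|j] //.
  by rewrite ltnS => jk; rewrite -eN ?ej //; lia.
have nx : x ^+ N <= d / (6 * C + 1) by apply: hN0; rewrite leq_addr.
have := @orbit_center_le N m ltac:(lia).
have := hd m.+1 ltac:(lia).
set S := \sum_(j < N) _ => h1 h2.
have eS : (s m)%:~R * S + x ^+ 2 = x * \sum_(j < N) x ^+ j * (e j)%:~R.
  rewrite !mulr_sumr.
  have -> : x ^+ 2 = \sum_(j < N) x ^+ j.+1 * (j == 1%N :> nat)%:R.
    have N1 : (1 < N)%N by rewrite /N; lia.
    rewrite (bigD1 (Ordinal N1)) //= mulr1 big1 ?addr0 // => i i1.
    suff -> : (i == 1%N :> nat) = false by rewrite mulr0.
    by apply: contraNF i1 => /eqP i1; apply/eqP/val_inj.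
  rewrite -big_split; apply: eq_bigr => j _ /=.
  rewrite eN // /digit -/(window s m j.+1) eqSS (intrD _ (s m * window s m j.+1)) intrM exprS.
  by rewrite -[((_ == _)%:Z)%:~R]/((_ == _)%:R); ring.
have nx' : 3 * C * x ^+ N < d.
  apply: le_lt_trans (_ : 3 * C * (d / (6 * C + 1)) < _).
    by rewrite ler_wpM2l //; lra.
  rewrite mulrA ltr_pdivrMr; nra.
(* The quantity 1 + s m * S is within less than d of s m * (a + x) * E, which is at most 1 - x ^+ 2
   - d; so s m * S + x ^+ 2 is negative. *)
suff : x * \sum_(j < N) x ^+ j * (e j)%:~R < 0 by rewrite pmulr_rlt0.
rewrite -eS; move: h1 h2; set E := eps m.+1; set xN := x ^+ N in nx' *.
have ax0 : 0 < a + x by lra.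
have -> : (a + x) * `|E| = `|(a + x) * E| by rewrite normrM gtr0_norm.
move: (_ * E) => Q; move=> h1; rewrite ler_norml => /andP[h2 h4].
have := ler_norm Q; have := ler_norm (- Q); rewrite normrN.
move: h2 h4.
by case: s2 => ->; rewrite ?mulr1z ?mulrN1z ?mulN1r ?mul1r; lra.
Qed.

End Orbit.
End Dynamics.

(** Summation by parts. At a boundary the even windows, multiplied by the sign of the step, are
    differences of consecutive values of [asymmetry], and the factor 1 - y of L comes out. *)
Lemma abel_sum (K : comNzRingType) (y : K) (d : nat -> K) T :
  d 0%N + \sum_(i < T) y ^+ i.+1 * (d i.+1 - d i) =
  (1 - y) * \sum_(i < T) y ^+ i * d i + y ^+ T * d T.
Proof.
elim: T => [|T IH]; first by rewrite !big_ord0; ring.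
by rewrite !big_ord_recr /= addrA IH exprS; ring.
Qed.

Section Word.
Variables (s : nat -> int) (v : nat -> bool).

(** The value [s 0] is left free: for a word read off an orbit it is the nonzero step at m0. *)
Definition word_steps : Prop := forall j, s j.*2.+1 = 0 /\
  s j.*2.+2 = (v j.+1)%:Z - (v j)%:Z.

(* Compares the two halves of [v] at distance [i] from the boundary between [j]
   and [j.+1]; it is 1 at [i = 0], and negative at the first difference when [v]
   has Markoff's property. *)
Definition asymmetry (j i : nat) : int :=
  ((v j.+1)%:Z - (v j)%:Z) * ((v (j.+1 + i)%N)%:Z - (v (j - i)%N)%:Z).

Lemma asymmetry0 j : v j != v j.+1 -> asymmetry j 0 = 1.
Proof. by rewrite /asymmetry addn0 subn0; case: (v _) (v _) => [] []. Qed.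

Lemma asymmetry_le1 j i : `|asymmetry j i| <= 1.
Proof.
rewrite /asymmetry; move: (v _) (v _) (v _) (v _); by do 4 case.
Qed.

Lemma asymmetry_eq0 j i : v (j.+1 + i)%N = v (j - i)%N -> asymmetry j i = 0.
Proof. by rewrite /asymmetry => ->; rewrite subrr mulr0. Qed.

Lemma asymmetry_eqN1 j i : v j != v j.+1 -> v (j.+1 + i)%N = v j ->
  v (j - i)%N = v j.+1 -> asymmetry j i = -1.
Proof. by rewrite /asymmetry => + -> ->; move: (v _) (v _) => [] []. Qed.

Hypothesis sv : word_steps.

Lemma word_steps_le1 m : (0 < m)%N -> `|s m| <= 1.
Proof.
case: m => // m _; rewrite -[m]odd_double_half; case: (odd m) => /=.
  by rewrite add1n (sv _).2; case: (v _) (v _) => [] [].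
by rewrite add0n (sv _).1.
Qed.

Lemma word_steps_odd m : odd m -> s m = 0.
Proof. by move=> om; rewrite -[m]odd_double_half om add1n (sv _).1. Qed.

End Word.

(** With y = x ^+ 2 this says 2 x / (1 - y) <= (1 - y) / (1 + y): the bound at a position without a
    step does not exceed the boundary value of the word of period 2, the smallest nonzero one. *)
Lemma small_center_bound (R : realType) (x : R) : 0 < x -> x < 3^-1 ->
  2 * x * (1 + x ^+ 2) <= (1 - x ^+ 2) ^+ 2.
Proof.
move=> x0 x1.
have h2 : x * x <= x * 3^-1 by rewrite ler_pM2l // ltW.
have h3 : x * (x * x) <= x * (x * 3^-1) by rewrite ler_pM2l.
have h4 : 0 <= x * x * (x * x) by rewrite mulr_ge0 // mulr_ge0 // ltW.
by rewrite !expr2; lra.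
Qed.

(** * From boundary sums of a word to the limsup of its orbit *)

Section Eval.
Variables (R : realType) (a : R) (b : int).
Hypothesis a3 : 3 < a.
Hypothesis ab : a ^+ 2 = b%:~R * a + 1.
Local Notation x := (a^-1).
Variables (eps : nat -> R) (s : nat -> int) (C : R).
Hypothesis epsS : forall m, eps m.+2 = b%:~R * eps m.+1 + eps m - (s m)%:~R.
Hypothesis epsC : forall m, `|eps m| <= C.
Variable v : nat -> bool.
Hypothesis sv : word_steps s v.
Local Notation y := (x ^+ 2).
Local Notation D := (asymmetry v).

Lemma y_facts : [/\ 0 < y, y < 9^-1 & y <= x].
Proof.
have [a0 x0 x1 _ _] := inv_facts a3 ab.
have h2 : x * x <= x * 3^-1 by rewrite ler_pM2l // ltW.
by split; [exact: exprn_gt0|rewrite expr2; lra|rewrite expr2; lra].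
Qed.

(** The error has two sources: 3 C x ^+ (2 T) from cutting the expansion and y ^+ T from the last
    term of the summation by parts. *)
Lemma eval_boundary j T : (T <= j)%N -> v j != v j.+1 ->
  `|(s j.*2.+2)%:~R * ((a + x) * eps j.*2.+3)
    - (1 - y) * \sum_(i < T) y ^+ i * (D j i)%:~R| <= (1 + 3 * C) * y ^+ T.
Proof.
move=> Tj vj; set m := j.*2.+2; set sg : R := (s m)%:~R.
have sE : s m = (v j.+1)%:Z - (v j)%:Z by rewrite (sv _).2.
have sg1 : `|sg| = 1.
  by rewrite /sg sE; case: (v j) (v j.+1) vj => [] [] // _;
    rewrite ?subr0 ?sub0r ?intrN ?normrN normr1.
have sg2 : sg * sg = 1.
  by rewrite /sg -intrM sE; case: (v j) (v j.+1) vj => [] [].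
have := orbit_center_le a3 ab epsS epsC (N := T.*2) (m := m) ltac:(rewrite /m; lia).
rewrite (sum_pairs (fun j => x ^+ j.+1 * (window s m j.+1)%:~R)) /=.
set S := \sum_(i < T) _.
have SE : sg * S = \sum_(i < T) y ^+ i.+1 * ((D j i.+1)%:~R - (D j i)%:~R).
  rewrite mulr_sumr; apply: eq_bigr => i _; have iT := ltn_ord i.
  have -> : window s m i.*2.+1 = 0.
    by rewrite /window !(word_steps_odd sv) ?oppr0 ?if_same //; rewrite /m; lia.
  have -> : window s m i.*2.+2 =
      (v (j + i.+1).+1)%:Z - (v (j + i.+1)%N)%:Z
      + ((v (j - i)%N)%:Z - (v (j - i.+1)%N)%:Z).
    rewrite /window /= odd_double /=.
    rewrite (_ : (m + i.*2.+2 = (j + i.+1).*2.+2)%N); last by rewrite /m; lia.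
    rewrite (_ : (m - i.*2.+2 = (j - i.+1).*2.+2)%N); last by rewrite /m; lia.
    by rewrite !(sv _).2 (_ : ((j - i.+1).+1 = j - i)%N) //; lia.
  rewrite mulr0 add0r /sg sE -exprM mulrCA -intrM -intrB; congr (_ * _).
    by congr (_ ^+ _); lia.
  congr (_%:~R); rewrite /asymmetry -mulrBr; congr (_ * _).
  by rewrite addSn addSn addnS; ring.
have D0 : (D j 0)%:~R = 1 :> R by rewrite asymmetry0.
have := abel_sum y (fun i => (D j i)%:~R) T; rewrite D0 -SE => A.
have -> : x ^+ T.*2 = y ^+ T by rewrite -exprM mul2n.
have yT : 0 <= y ^+ T by rewrite exprn_ge0 // sqr_ge0.
move=> h; have := ler_distD (1 + sg * S) (sg * ((a + x) * eps j.*2.+3))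
  ((1 - y) * \sum_(i < T) y ^+ i * (D j i)%:~R).
have -> : sg * ((a + x) * eps j.*2.+3) - (1 + sg * S) =
  sg * ((a + x) * eps m.+1 - (sg + S)) by rewrite /m mulrBr mulrDr sg2.
rewrite normrM sg1 mul1r.
rewrite [1 + sg * S]A addrAC subrr add0r normrM (ger0_norm yT).
have : y ^+ T * `|(D j T)%:~R : R| <= y ^+ T * 1.
  by rewrite ler_wpM2l // -intr_norm (ler_int R _ 1) asymmetry_le1.
move=> h1 h2; apply: le_trans h2 _; move: h h1; lra.
Qed.

(** Only one parity of distances reaches the even positions that carry steps, and each window is at
    most 2 in absolute value. The odd distances give 2 x / (1 - y), the even ones 2 y / (1 - y),
    which is smaller. *)
Lemma eval_zero m T : (T.*2 < m)%N -> s m = 0 ->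
  `|(a + x) * eps m.+1| <= 2 * x / (1 - y) + 3 * C * y ^+ T.
Proof.
move=> Tm sm; have [y0 y1 yx] := y_facts; have [a0 x0 x1 _ _] := inv_facts a3 ab.
have := orbit_center_le a3 ab epsS epsC (N := T.*2) (m := m) (ltnW Tm).
rewrite sm add0r.
rewrite (sum_pairs (fun j => x ^+ j.+1 * (window s m j.+1)%:~R)) -mul2n exprM /=.
set S := \sum_(i < T) _ => h.
have -> : (a + x) * eps m.+1 = ((a + x) * eps m.+1 - S) + S by rewrite subrK.
apply: le_trans (ler_normD _ _) _; rewrite addrC lerD //.
pose w i : R := if (i < T)%N then x * (window s m i.*2.+1)%:~R
  + y * (window s m i.*2.+2)%:~R else 0.
have -> : S = \sum_(i < T) y ^+ i * w i.
  apply: eq_bigr => i _; rewrite /w ltn_ord.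
  have -> : x ^+ i.*2.+1 = x * y ^+ i by rewrite exprS -mul2n exprM.
  have -> : x ^+ i.*2.+2 = y * y ^+ i by rewrite -addn2 exprD -mul2n exprM mulrC.
  by move: (y) => z; ring.
apply: geometric_sum_le; first by apply/andP; split; lra.
move=> i; rewrite /w; case: ifP => iT; last by rewrite normr0; lra.
have sle k : (0 < k)%N -> -1 <= ((s k)%:~R : R) <= 1.
  by move=> k0; rewrite -ler_norml -intr_norm (ler_int R _ 1) (word_steps_le1 sv).
have [om|em] := boolP (odd m).
  have -> : window s m i.*2.+2 = 0.
    by rewrite /window !(word_steps_odd sv) ?oppr0 ?if_same //; clear -Tm iT om; lia.
  rewrite mulr0 addr0 normrM (gtr0_norm x0) mulrC ler_wpM2r //; first lra.
  rewrite /window /= odd_double /= intrD intrN.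
  have := sle (m + i.*2.+1)%N ltac:(clear -Tm iT; lia).
  have := sle (m - i.*2.+1)%N ltac:(clear -Tm iT; lia).
  by move=> /andP[h1 h2] /andP[h3 h4]; rewrite ler_norml; apply/andP; split; lra.
have -> : window s m i.*2.+1 = 0.
  by rewrite /window !(word_steps_odd sv) ?oppr0 ?if_same //; clear -Tm iT em; lia.
rewrite mulr0 add0r normrM (gtr0_norm y0).
apply: le_trans (_ : y * 2 <= _); last by lra.
rewrite ler_wpM2l //; first lra.
rewrite /window /= odd_double /= intrD.
have := sle (m + i.*2.+2)%N ltac:(clear -Tm iT; lia).
have := sle (m - i.*2.+2)%N ltac:(clear -Tm iT; lia).
by move=> /andP[h1 h2] /andP[h3 h4]; rewrite ler_norml; apply/andP; split; lra.
Qed.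

(** Since l >= 1 / (1 + y), positions with s m = 0 stay below the claimed value by
    [small_center_bound], and the limsup is decided at the boundaries. *)
Lemma eval_limsup (l : R) : 1 <= l * (1 + y) -> l <= 1 ->
  (forall e : R, 0 < e -> exists T J, y ^+ T <= e /\ forall j, (J <= j)%N ->
     v j != v j.+1 -> \sum_(i < T) y ^+ i * (D j i)%:~R <= l + e) ->
  (forall e : R, 0 < e -> exists T, y ^+ T <= e /\ forall J, exists j,
     [/\ (J <= j)%N, v j != v j.+1 &
         l - e <= \sum_(i < T) y ^+ i * (D j i)%:~R]) ->
  is_limsup (fun m => `|eps m|) ((1 - y) * l / (a + x)).
Proof.
move=> l1 l2 hup hlow.
have [y0 y1 yx] := y_facts; have [a0 x0 x1 _ _] := inv_facts a3 ab.
have C0 : 0 <= C := le_trans (normr_ge0 _) (epsC 0%N).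
have ax0 : 0 < a + x by lra.
have zl : 2 * x / (1 - y) <= (1 - y) * l.
  have : 2 * x * (1 + y) <= (1 - y) ^+ 2 by exact: small_center_bound.
  rewrite ler_pdivrMr; last lra.
  move=> h; rewrite -(@ler_pM2r _ (1 + y)); last lra.
  apply: le_trans h _; rewrite expr2.
  have -> : (1 - y) * l * (1 - y) * (1 + y) = (1 - y) * (1 - y) * (l * (1 + y)).
    by ring.
  by rewrite ler_peMr // mulr_ge0 //; lra.
have K0 : 0 < 2 + 3 * C by lra.
(* The factor 2 + 3 C collects the error 1 + 3 C of [eval_boundary] and one more e' from the
   estimate of the sum. *)
have scale (e : R) : 0 < e ->
    exists2 e', 0 < e' & (2 + 3 * C) * e' = e * (a + x).
  move=> e0; exists (e * (a + x) / (2 + 3 * C)).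
    by rewrite divr_gt0 // mulr_gt0.
  by rewrite mulrC divfK // gt_eqF.
split=> [e /scale[e' e'0 e'E]|e M /scale[e' e'0 e'E]].
  have [T [J [yT hB]]] := hup _ e'0.
  exists (J + T).*2.+4 => -[//|m] Jm.
  have Ce : 3 * C * y ^+ T <= 3 * C * e' by rewrite ler_wpM2l //; lra.
  rewrite -(ler_pM2l ax0) mulrDr mulrCA divff ?gt_eqF // mulr1.
  rewrite [(a + x) * e]mulrC -e'E -[(a + x) in leLHS](gtr0_norm ax0) -normrM.
  have [s0|sn0] := eqVneq (s m) 0.
    have := @eval_zero m T ltac:(clear -Jm; lia) s0.
    by move: zl Ce e'0; lra.
  have em : ~~ odd m by apply: contra_neqN sn0 => om; rewrite (word_steps_odd sv).
  have mE : m = (m./2.-1).*2.+2 by clear -em Jm; lia.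
  set j := m./2.-1 in mE.
  have vj : v j != v j.+1.
    by apply: contra_neq sn0 => vj; rewrite mE (sv _).2 vj subrr.
  have := @eval_boundary j T ltac:(clear -mE Jm; lia) vj; rewrite -mE.
  have := hB j ltac:(clear -mE Jm; lia) vj.
  set B := \sum_(i < T) _ => h1 h2.
  have B0 : 0 <= B.
    rewrite /B; case: (T) => [|T']; first by rewrite big_ord0.
    rewrite big_ord_recl /= asymmetry0 // mulr1 expr0.
    under eq_bigr => i _ do rewrite /bump /= add1n exprS -mulrA.
    rewrite -mulr_sumr.
    have := @geometric_sum_le R y 1 (fun i => (D j i.+1)%:~R) T'
      ltac:(by apply/andP; split; lra)
      ltac:(by move=> i /=; rewrite -intr_norm (ler_int R _ 1) asymmetry_le1).
    rewrite ler_norml => /andP[h3 _].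
    have h4 : 1 / (1 - y) <= 2 by rewrite ler_pdivrMr; lra.
    have h5 : y * - 2 <= y * \sum_(i < T') y ^+ i * (D j i.+1)%:~R.
      by rewrite ler_pM2l //; lra.
    lra.
  have nE : `|(a + x) * eps m.+1| = `|(s m)%:~R * ((a + x) * eps m.+1)|.
    rewrite [RHS]normrM -intr_norm.
    have -> : `|s m| = 1.
      have := word_steps_le1 sv (ltac:(clear -Jm; lia) : (0 < m)%N).
      by move: sn0; clear; lia.
    by rewrite mul1r.
  rewrite nE.
  have := ler_normD ((s m)%:~R * ((a + x) * eps m.+1) - (1 - y) * B) ((1 - y) * B).
  rewrite subrK (normrM (1 - y) B) (ger0_norm B0) (@gtr0_norm _ (1 - y)); last lra.
  have h6 : (1 - y) * B <= (1 - y) * l + (1 - y) * e'.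
    by rewrite -mulrDr ler_wpM2l //; lra.
  have h7 : (1 - y) * e' <= e' by rewrite ger_pMl //; lra.
  move=> h8; apply: le_trans h8 _.
  by move: h2 h6 h7 Ce yT; lra.
have [T [yT hB]] := hlow _ e'0; have [j [Jj vj jB]] := hB (M + T)%N.
have Ce : 3 * C * y ^+ T <= 3 * C * e' by rewrite ler_wpM2l //; lra.
exists j.*2.+3; first by clear -Jj; lia.
have := @eval_boundary j T ltac:(clear -Jj; lia) vj.
move: jB; set B := \sum_(i < T) _ => h1 h0.
rewrite -(ler_pM2l ax0) mulrBr mulrCA divff ?gt_eqF // mulr1.
rewrite [(a + x) * e]mulrC -e'E -[(a + x) in leRHS](gtr0_norm ax0) -normrM.
have -> : `|(a + x) * eps j.*2.+3| =
    `|(s j.*2.+2)%:~R * ((a + x) * eps j.*2.+3)|.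
  rewrite [RHS]normrM -intr_norm.
  have -> : `|s j.*2.+2| = 1.
    by rewrite (sv _).2; case: (v j) (v j.+1) vj => [] [].
  by rewrite mul1r.
move: h0; rewrite ler_norml => /andP[h2 _].
have := ler_norm ((s j.*2.+2)%:~R * ((a + x) * eps j.*2.+3)).
have h6 : (1 - y) * (l - e') <= (1 - y) * B by rewrite ler_wpM2l //; lra.
have h7 : (1 - y) * e' <= e' by rewrite ger_pMl //; lra.
by move: h2 h6 h7 Ce yT; move: (_%:~R * _) => Q; lra.
Qed.
End Eval.

(* The values of [asymmetry] at a boundary of maximal depth [P.-1] in a word of
   period [P]. *)
Definition periodic_digit (P i : nat) : int := (P %| i)%:Z - (P %| i.+1)%:Z.

Lemma periodic_digit_sum (K : comNzRingType) (y : K) P t : (1 < P)%N ->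
  (1 - y ^+ P) * \sum_(i < P * t) y ^+ i * (periodic_digit P i)%:~R =
  (1 - y ^+ P.-1) * (1 - y ^+ (P * t)).
Proof.
move=> P1; elim: t => [|t IH].
  by rewrite muln0 big_ord0 expr0 subrr !mulr0.
rewrite mulnS big_split_ord /=.
have -> : \sum_(i < P) y ^+ i * (periodic_digit P i)%:~R = 1 - y ^+ P.-1.
  case: P P1 {IH} => [|[|P]] // _.
  rewrite big_ord_recl big_ord_recr /= /bump /= add1n.
  rewrite /periodic_digit dvdn0 dvdn1 dvdnn /= expr0 mul1r.
  rewrite big1 => [|i _]; last first.
    rewrite /periodic_digit /bump /= add1n !gtnNdvd ?subrr ?mulr0 //.
      by have := ltn_ord i; rewrite !ltnS.
    by have := ltn_ord i; lia.
  by rewrite gtnNdvd // add0r mulrN1 subr0.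
under eq_bigr => i _ do
  rewrite exprD -mulrA /periodic_digit -addnS !dvdn_addr ?dvdnn // -/(periodic_digit P i).
rewrite -mulr_sumr mulrDr mulrCA IH exprD; ring.
Qed.

(** For the shallower boundaries of a periodic word: after the drop by y ^+ k the tail regains at
    most 2 y ^+ k.+1, and 3 y <= 1. *)
Lemma first_drop_sum_le (R : realType) (y : R) (d : nat -> int) k T :
  0 < y -> y < 9^-1 -> d 0%N = 1 -> (forall i, `|d i| <= 1) ->
  (0 < k < T)%N -> (forall i, (0 < i < k)%N -> d i = 0) -> d k = -1 ->
  \sum_(i < T) y ^+ i * (d i)%:~R <= 1 - y ^+ k.+1.
Proof.
move=> y0 y1 d0 d1 /andP[k0 kT] dz dk.
rewrite -(subnKC (ltnW kT)) big_split_ord /=.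
have -> : \sum_(i < k) y ^+ i * (d i)%:~R = 1.
  rewrite -(prednK k0) big_ord_recl /= d0 expr0 mulr1 big1 ?addr0 // => i _.
  by rewrite /bump /= add1n dz ?mulr0 //; have := ltn_ord i; clear -k0; lia.
rewrite -[in X in _ + X](prednK (_ : 0 < T - k)%N) ?subn_gt0 //.
rewrite big_ord_recl /= addn0 dk.
have -> : \sum_(i < (T - k).-1) y ^+ (k + bump 0 i) * (d (k + bump 0 i)%N)%:~R =
  y ^+ k.+1 * \sum_(i < (T - k).-1) y ^+ i * (d (k.+1 + i)%N)%:~R.
  rewrite mulr_sumr; apply: eq_bigr => i _.
  by rewrite /bump /= add1n -addSnnS exprD mulrA.
have := @geometric_sum_le R y 1 (fun i => (d (k.+1 + i)%N)%:~R) (T - k).-1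
  ltac:(by apply/andP; split; lra)
  ltac:(by move=> i /=; rewrite -intr_norm (ler_int R _ 1)).
rewrite ler_norml => /andP[_]; move: (\sum_(i < _) _) => S h.
have h4 : 1 / (1 - y) <= 2 by rewrite ler_pdivrMr; lra.
have yk : 0 < y ^+ k by rewrite exprn_gt0.
rewrite exprS.
have : y ^+ k * (y * (1 + S)) <= y ^+ k * 1.
  rewrite ler_pM2l //; apply: le_trans (_ : y * 3 <= _); last by lra.
  by rewrite ler_pM2l //; lra.
by lra.
Qed.

Section Limsups.
Variables (R : realType) (a : R) (b : int).
Hypothesis a3 : 3 < a.
Hypothesis ab : a ^+ 2 = b%:~R * a + 1.
Local Notation x := (a^-1).
Variables (eps : nat -> R) (s : nat -> int) (C : R).
Hypothesis epsS : forall m, eps m.+2 = b%:~R * eps m.+1 + eps m - (s m)%:~R.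
Hypothesis epsC : forall m, `|eps m| <= C.
Variable v : nat -> bool.
Hypothesis sv : word_steps s v.
Local Notation y := (x ^+ 2).
Local Notation D := (asymmetry v).

Lemma sparse_limsup :
  (forall T, exists J, forall j, (J <= j)%N -> v j != v j.+1 ->
     forall i, (0 < i < T)%N -> v (j.+1 + i)%N = v (j - i)%N) ->
  (forall J, exists2 j, (J <= j)%N & v j != v j.+1) ->
  is_limsup (fun m => `|eps m|) ((1 - y) / (a + x)).
Proof.
move=> hs hb; have [y0 y1 yx] := y_facts a3 ab.
have B1 j T : v j != v j.+1 ->
    (forall i, (0 < i < T.+1)%N -> v (j.+1 + i)%N = v (j - i)%N) ->
    \sum_(i < T.+1) y ^+ i * (D j i)%:~R = 1.
  move=> vj hj; rewrite big_ord_recl /= asymmetry0 // expr0 mulr1.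
  rewrite big1 ?addr0 // => i _; rewrite asymmetry_eq0 ?mulr0 //.
  by apply: hj; rewrite /bump /= add1n ltnS ltn_ord.
have small e : 0 < e -> exists T, y ^+ T.+1 <= e.
  move=> e0; have [|T hT] := @expr_small R y e _ e0.
    by apply/andP; split; lra.
  by exists T; apply: hT.
rewrite -[1 - y]mulr1; apply: (eval_limsup a3 ab epsS epsC sv) => //.
- by lra.
- move=> e e0; have [T hT] := small e e0; have [J hJ] := hs T.+1.
  exists T.+1, J; split=> // j Jj vj; rewrite B1 //; first by lra.
  exact: hJ.
- move=> e e0; have [T hT] := small e e0; have [J hJ] := hs T.+1.
  exists T.+1; split=> // J'; have [j Jj vj] := hb (J + J')%N.
  have Jj' : (J <= j)%N by clear -Jj; lia.
  exists j; split=> //; first by clear -Jj; lia.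
  by rewrite B1 //; [lra|exact: hJ].
Qed.

(** At a deepest boundary [asymmetry] coincides with [periodic_digit], which gives the value.
    Shallower boundaries contribute at most 1 - y ^+ P.-1 by [first_drop_sum_le], which is below
    it. *)
Lemma deep_periodic_limsup P M N : markoff v M N -> deep_periodic v P ->
  is_limsup (fun m => `|eps m|)
    ((1 - y) * ((1 - y ^+ P.-1) / (1 - y ^+ P)) / (a + x)).
Proof.
move=> mv [P1 [M0 vP] dP]; have [y0 y1 yx] := y_facts a3 ab.
have n0 : (0 < P.-1)%N by clear -P1; lia.
have yle k : y ^+ k.+1 <= y.
  by rewrite exprS ger_pMr // exprn_ile1 //; lra.
have yP : y ^+ P = y * y ^+ P.-1 by rewrite -exprS prednK //; clear -P1; lia.
have yn0 : 0 < y ^+ P.-1 by rewrite exprn_gt0.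
have yn1 : y ^+ P.-1 <= y by rewrite -(prednK n0).
set n := P.-1 in n0 yP yn0 yn1 *; set z := y ^+ n in yP yn0 yn1 *.
have zz : y * z < z by rewrite gtr_pMl //; lra.
have yz0 : 0 < y * z by rewrite mulr_gt0.
have l1 : 1 - z <= (1 - z) / (1 - y ^+ P).
  rewrite ler_pdivlMr; last by lra.
  by rewrite ger_pMr; lra.
have l2 : (1 - z) / (1 - y ^+ P) <= 1 by rewrite ler_pdivrMr; lra.
have vq q i : (M0 <= i)%N -> v (i + P * q)%N = v i.
  move=> Mi; elim: q => [|q IH]; first by rewrite muln0 addn0.
  by rewrite mulnSr addnA vP ?IH //; clear -Mi; lia.
have DE j t : v j != v j.+1 -> (M0 + P * t <= j)%N ->
    (forall i, (0 < i < n)%N -> v (j.+1 + i)%N = v (j - i)%N) ->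
    forall i, (i < P * t)%N -> D j i = periodic_digit P i.
  move=> vj Mj hj i it.
  have P0 : (0 < P)%N by clear -P1; lia.
  have iP := divn_eq i P; have rP := ltn_pmod i P0.
  move: iP rP; set q := (i %/ P)%N; set r := (i %% P)%N => iP rP.
  have -> : D j i = D j r.
    rewrite /asymmetry iP; congr (_ * (_%:Z - _%:Z)).
      rewrite (_ : (j.+1 + (q * P + r) = j.+1 + r + P * q)%N) ?vq //.
        by clear -Mj; lia.
      by clear; lia.
    rewrite -(vq q (j - (q * P + r))%N); last by clear -Mj it iP; lia.
    by congr (v _); clear -Mj it iP; lia.
  have -> : periodic_digit P i = periodic_digit P r.
    by rewrite /periodic_digit iP -addnS !dvdn_addr ?dvdn_mull.
  rewrite /periodic_digit.
  have [r0|r0] := posnP r; first by rewrite r0 asymmetry0 // dvdn0 dvdn1 gtn_eqF.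
  rewrite (gtnNdvd r0 rP).
  have [rn|rn] := ltnP r n.
    rewrite asymmetry_eq0 ?hj ?r0 // gtnNdvd //.
    by move: rn; rewrite /n; clear; lia.
  have rE : r.+1 = P by move: rn rP; rewrite /n; clear; lia.
  rewrite rE dvdnn asymmetry_eqN1 //.
    by rewrite (_ : (j.+1 + r = j + P)%N) ?vP // -?rE; clear -Mj; lia.
  rewrite -vP; last by clear -Mj it iP rE; lia.
  by congr (v _); clear -Mj it iP rE; lia.
have BE j t : v j != v j.+1 -> (M0 + P * t <= j)%N ->
    (forall i, (0 < i < n)%N -> v (j.+1 + i)%N = v (j - i)%N) ->
    \sum_(i < P * t) y ^+ i * (D j i)%:~R =
    (1 - z) / (1 - y ^+ P) * (1 - y ^+ (P * t)).
  move=> vj Mj hj.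
  have -> : \sum_(i < P * t) y ^+ i * (D j i)%:~R =
      \sum_(i < P * t) y ^+ i * (periodic_digit P i)%:~R.
    by apply: eq_bigr => i _; rewrite (DE j t).
  have nz : 1 - y ^+ P != 0 by rewrite gt_eqF //; lra.
  apply: (mulfI nz); rewrite periodic_digit_sum // -/n -/z.
  by rewrite mulrA mulrCA divff // mulr1.
have small e : 0 < e -> exists t, (0 < t)%N /\ y ^+ (P * t) <= e.
  move=> e0; have [|T hT] := @expr_small R y e _ e0.
    by apply/andP; split; lra.
  by exists T.+1; split=> //; apply: hT; rewrite mulnS; clear -P1; nia.
apply: (eval_limsup a3 ab epsS epsC sv) => //.
- have -> : (1 - z) / (1 - y ^+ P) * (1 + y) = (1 - z) * (1 + y) / (1 - y ^+ P).
    by rewrite mulrAC.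
  by rewrite ler_pdivlMr; [rewrite yP; lra|lra].
- move=> e e0; have [t [t0 yt]] := small e e0.
  have yt0 : 0 < y ^+ (P * t) by rewrite exprn_gt0.
  exists (P * t)%N, (M + M0 + P * t)%N; split=> // j Jj vj.
  have [|k [/andP[k0 kN] kE k1 k2]] := mv j _ vj; first by clear -Jj; lia.
  have Pt : (P <= P * t)%N by rewrite leq_pmulr.
  (* At distance n = P - 1 the period shows v j on the right and v j.+1 on the left, so the
     agreement cannot extend to n. *)
  have kn : (k <= n)%N.
    rewrite leqNgt; apply/negP => nk; move: vj.
    have := kE n; rewrite n0 nk => /(_ isT).
    rewrite (_ : (j.+1 + n = j + P)%N); last by rewrite /n; clear -P1; lia.
    rewrite vP; last by clear -Jj; lia.
    rewrite -(vP (j - n)%N); last by rewrite /n; clear -Jj Pt P1; lia.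
    rewrite (_ : (j - n + P = j.+1)%N); last by rewrite /n; clear -Jj Pt P1; lia.
    by move=> ->; rewrite eqxx.
  have [kn'|kn'] := eqVneq k n.
    rewrite BE -?kn' //; last by clear -Jj; lia.
    apply: le_trans (_ : (1 - z) / (1 - y ^+ P) * 1 <= _); last by lra.
    by rewrite ler_wpM2l; lra.
  apply: le_trans (_ : 1 - y ^+ k.+1 <= _).
    apply: first_drop_sum_le => //.
    + by rewrite asymmetry0.
    + by move=> i; exact: asymmetry_le1.
    + by rewrite k0; move: kn Pt; rewrite /n; clear -P1; lia.
    + by move=> i /kE; exact: asymmetry_eq0.
    + exact: asymmetry_eqN1.
  have : z <= y ^+ k.+1.
    by rewrite /z; apply: ler_wiXn2l; [lra|lra|rewrite ltn_neqAle kn' kn].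
  by lra.
- move=> e e0; have [t [t0 yt]] := small e e0.
  have yt0 : 0 < y ^+ (P * t) by rewrite exprn_gt0.
  exists (P * t)%N; split=> // J; have [j [Aj vj hj]] := dP (J + M0 + P * t)%N.
  exists j; split=> //; first by clear -Aj; lia.
  rewrite BE //; last by clear -Aj; lia.
  move: l1 l2; set l := _ / _ => l1 l2; rewrite mulrBr mulr1 lerD2l lerN2.
  by apply: le_trans yt; rewrite ger_pMl //; lra.
Qed.
End Limsups.

(** * Orbits with prescribed steps, and the closed form of the values *)

Section Construction.
Variables (R : realType) (a : R) (b : int).
Hypothesis a3 : 3 < a.
Hypothesis ab : a ^+ 2 = b%:~R * a + 1.
Local Notation x := (a^-1).
Local Notation y := (x ^+ 2).

(** The combination k m = u m.+1 + x * u m is multiplied by a and shifted by s m at each step. Hence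
    x ^+ m * k m converges, and xi is its limit divided by a + x; the limit is obtained as a
    supremum of left ends of nested intervals. *)
Lemma exists_orbit (s : nat -> int) : (forall m, `|s m| <= 1) ->
  exists xi (u : nat -> int) (C : R),
    (forall m, u m.+2 = b * u m.+1 + u m + s m) /\
    (forall m, `|xi * a ^+ m - (u m)%:~R| <= C).
Proof.
move=> s1; have [a0 x0 x1 ax bE] := inv_facts a3 ab.
pose f := fix f m : int * int := if m is m'.+1 then
  ((f m').2, b * (f m').2 + (f m').1 + s m') else (0, 0).
pose u m := (f m).1.
have uS m : u m.+2 = b * u m.+1 + u m + s m by [].
pose k m : R := (u m.+1)%:~R + x * (u m)%:~R.
have kS m : k m.+1 = a * k m + (s m)%:~R.
  rewrite /k uS !intrD intrM bE; ring: ax.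
(* This is the sum of x ^+ j over j >= 1, which bounds the remaining variation of [w] after m in
   units of x ^+ m and makes the intervals w m +- c x ^+ m nested. *)
pose c := x / (1 - x).
have cE : x + x * c = c.
  have : c * (1 - x) = x by rewrite divfK // gt_eqF //; lra.
  by lra.
have c0 : 0 < c by rewrite /c divr_gt0 //; lra.
pose w m := x ^+ m * k m.
have xs m : - x <= x * (s m)%:~R <= x.
  have : -1 <= ((s m)%:~R : R) <= 1 by rewrite -ler_norml -intr_norm (ler_int R _ 1).
  by rewrite -(ler_pM2l x0) -[_ <= 1](ler_pM2l x0) mulrN mulr1.
have wS m : w m.+1 = w m + x ^+ m * (x * (s m)%:~R).
  by rewrite /w kS exprSr; ring: ax.
have lo m i : w m - c * x ^+ m <= w (m + i)%N - c * x ^+ (m + i).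
  elim: i => [|i IH]; first by rewrite addn0.
  apply: le_trans IH _; rewrite addnS wS exprSr.
  have xm : 0 <= x ^+ (m + i) by rewrite exprn_ge0 // ltW.
  have /andP[h _] := xs (m + i)%N.
  have : x ^+ (m + i) * 0 <= x ^+ (m + i) * (x * (s (m + i)%N)%:~R + c - c * x).
    by rewrite ler_wpM2l //; lra.
  by move: (x ^+ (m + i)) => X; lra.
have up m i : w (m + i)%N + c * x ^+ (m + i) <= w m + c * x ^+ m.
  elim: i => [|i IH]; first by rewrite addn0.
  apply: le_trans _ IH; rewrite addnS wS exprSr.
  have xm : 0 <= x ^+ (m + i) by rewrite exprn_ge0 // ltW.
  have /andP[_ h] := xs (m + i)%N.
  have : x ^+ (m + i) * 0 <= x ^+ (m + i) * (c - c * x - x * (s (m + i)%N)%:~R).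
    by rewrite ler_wpM2l //; lra.
  by move: (x ^+ (m + i)) => X; lra.
pose A := range (fun m => w m - c * x ^+ m).
have lu m n : w m - c * x ^+ m <= w n + c * x ^+ n.
  have h1 := lo m n; have h2 := up n m; rewrite addnC in h2.
  have : 0 <= c * x ^+ (m + n) by rewrite mulr_ge0 ?exprn_ge0 // ltW.
  lra.
have Aub n : ubound A (w n + c * x ^+ n) by move=> _ [m _ <-]; exact: lu.
have lK m : w m - c * x ^+ m <= sup A.
  by apply: ub_le_sup; [exists (w 0%N + c * x ^+ 0)|exists m].
have uK m : sup A <= w m + c * x ^+ m.
  by apply: ge_sup => //; exists (w 0%N - c * x ^+ 0), 0%N.
have ax0 : a + x != 0 by rewrite gt_eqF //; lra.
pose xi := sup A / (a + x).
pose eps m := xi * a ^+ m - (u m)%:~R.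
have epsk m : `|eps m.+1 + x * eps m| <= 1.
  have -> : eps m.+1 + x * eps m = sup A * a ^+ m - k m.
    have -> : sup A = xi * (a + x) by rewrite /xi divfK.
    by rewrite /eps /k exprS; ring.
  have am : 0 < a ^+ m by rewrite exprn_gt0.
  have e1 : a ^+ m * x ^+ m = 1 by rewrite -exprMn ax expr1n.
  have wk : w m * a ^+ m = k m by rewrite /w; ring: e1.
  have h1 := lK m; rewrite -(ler_pM2r am) mulrBl wk in h1.
  have h2 := uK m; rewrite -(ler_pM2r am) mulrDl wk in h2.
  rewrite -mulrA [x ^+ m * _]mulrC e1 mulr1 in h1.
  rewrite -mulrA [x ^+ m * _]mulrC e1 mulr1 in h2.
  have c1 : c <= 1 by rewrite /c ler_pdivrMr; lra.
  by rewrite ler_norml; apply/andP; split; lra.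
exists xi, u, (`|eps 0%N| + 2); split=> //.
elim=> [|m IH]; first by rewrite lerDl.
rewrite -/(eps m.+1); have -> : eps m.+1 = (eps m.+1 + x * eps m) - x * eps m.
  by rewrite addrK.
apply: le_trans (ler_normB _ _) _; rewrite normrM (gtr0_norm x0).
have h := epsk m.
have h1 : x * `|eps m| <= x * (`|eps 0%N| + 2) by rewrite ler_pM2l.
have h2 : x * (`|eps 0%N| + 2) <= 3^-1 * (`|eps 0%N| + 2).
  by rewrite ler_wpM2r ?ltW //; have := normr_ge0 (eps 0%N); lra.
by have := normr_ge0 (eps 0%N); lra.
Qed.

(** A limsup below 1/2 makes u m eventually the nearest integer, so that the deviations become true
    distances. *)
Lemma limsup_dist_eps xi (u : nat -> int) l :
  is_limsup (fun m => `|xi * a ^+ m - (u m)%:~R|) l -> l < 2^-1 ->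
  (exists M, forall m, (M <= m)%N -> `|xi * a ^+ m - (u m)%:~R| < 2^-1) /\
  limsup_dist a xi = l.
Proof.
move=> ul l2; have [h1 h2] := ul.
have [M hM] := h1 ((2^-1 - l) / 2) ltac:(lra).
have hM' m : (M <= m)%N -> `|xi * a ^+ m - (u m)%:~R| < 2^-1.
  by move=> /hM; move: (`|_|) => z h; lra.
split; first by exists M.
apply: is_limsup_unique (limsup_dist_is_limsup a xi) _.
split=> [e /h1[M' hM'']|e M' /(h2 _ (M + M')%N)[m Mm hm]].
  exists (M + M')%N => m Mm.
  rewrite (dist_int_small (ltW (hM' m _))); first by apply: hM''; clear -Mm; lia.
  by clear -Mm; lia.
exists m; first by clear -Mm; lia.
by rewrite (dist_int_small (ltW (hM' m _))) //; clear -Mm; lia.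
Qed.

Lemma orbit_recurrence xi (u s : nat -> int) m :
  u m.+2 = b * u m.+1 + u m + s m ->
  xi * a ^+ m.+2 - (u m.+2)%:~R = b%:~R * (xi * a ^+ m.+1 - (u m.+1)%:~R) +
    (xi * a ^+ m - (u m)%:~R) - (s m)%:~R.
Proof.
by move=> ->; rewrite !intrD intrM !exprS; ring: ab.
Qed.

(** The bounded combination h is determined by the later steps, so it inherits their period from M
    on. Unfolding one period gives h M = x ^+ q * h M + t with t in Q(a), and xi is a rational
    expression in h M, a and integers. *)
Lemma rat_adjoin_of_periodic xi (u s : nat -> int) C q M :
  (forall m, u m.+2 = b * u m.+1 + u m + s m) ->
  (forall m, `|xi * a ^+ m - (u m)%:~R| <= C) ->
  (0 < q)%N -> (forall m, (M <= m)%N -> s (m + q)%N = s m) ->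
  rat_adjoin a xi.
Proof.
move=> us uC q0 sq S [S1 Ssub Sdiv] aS.
have [a0 x0 x1 ax bE] := inv_facts a3 ab.
pose eps m := xi * a ^+ m - (u m)%:~R.
have epsS m : eps m.+2 = b%:~R * eps m.+1 + eps m - (s m)%:~R.
  exact: orbit_recurrence.
pose h m := eps m.+1 + x * eps m.
have hS m : h m = x * ((s m)%:~R + h m.+1).
  exact: (orbit_forward a3 ab epsS).
have C0 : 0 <= C := le_trans (normr_ge0 _) (uC 0%N).
have hC m : `|h m| <= 2 * C.
  apply: le_trans (ler_normD _ _) _; rewrite normrM (gtr0_norm x0).
  have h1 : x * `|eps m| <= x * C by rewrite ler_pM2l // uC.
  have h2 : x * C <= 1 * C by rewrite ler_wpM2r //; lra.
  by have := uC m.+1; rewrite -/(eps m.+1); lra.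
have hq k : h (M + q)%N - h M = x ^+ k * (h (M + k + q)%N - h (M + k)%N).
  elim: k => [|k IH]; first by rewrite addn0 expr0 mul1r.
  rewrite IH (hS (M + k + q)%N) (hS (M + k)%N) sq ?leq_addr //.
  by rewrite exprSr !addnS addSn; ring.
have hqE : h (M + q)%N = h M.
  apply/eqP; rewrite -subr_eq0; apply/eqP.
  apply/eqP; rewrite -normr_le0; apply/ler_addgt0Pl => e e0; rewrite addr0.
  have [||k hk] := @expr_small R x (e / (4 * C + 1)).
  - by apply/andP; split; lra.
  - by apply: divr_gt0; lra.
  rewrite (hq k) normrM normrX (gtr0_norm x0).
  have hb : `|h (M + k + q)%N - h (M + k)%N| <= 4 * C + 1.
    apply: le_trans (ler_normB _ _) _.
    by have := hC (M + k + q)%N; have := hC (M + k)%N; lra.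
  apply: le_trans (_ : e / (4 * C + 1) * (4 * C + 1) <= _); last first.
    by rewrite divfK // gt_eqF; lra.
  by apply: ler_pM => //; [rewrite exprn_ge0 // ltW|exact: hk].
have S0 : 0 \in S by rewrite -(subrr 1) Ssub.
have SN z : z \in S -> - z \in S by move=> zS; rewrite -sub0r Ssub.
have SD z t : z \in S -> t \in S -> z + t \in S.
  by move=> zS tS; rewrite -[t]opprK Ssub // SN.
have SV z : z \in S -> z^-1 \in S by move=> zS; rewrite -div1r Sdiv.
have SM z t : z \in S -> t \in S -> z * t \in S.
  by move=> zS tS; rewrite -[t]invrK Sdiv // SV.
have Snat n : n%:R \in S by elim: n => [//|n IH]; rewrite -addn1 natrD SD.
have Sint n : n%:~R \in S by case: n => n; rewrite ?NegzE ?intrN ?SN // Snat.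
have SX z n : z \in S -> z ^+ n \in S.
  by move=> zS; elim: n => [|n IH]; rewrite ?expr0 // exprS SM.
have hk k : exists2 t, t \in S & h M = x ^+ k * h (M + k)%N + t.
  elim: k => [|k [t tS tE]]; first by exists 0; rewrite // addn0 mul1r addr0.
  exists (x ^+ k.+1 * (s (M + k)%N)%:~R + t).
    by rewrite SD // SM // SX // SV.
  by rewrite tE (hS (M + k)%N) addnS exprSr; ring.
have [t tS tE] := hk q; rewrite hqE in tE.
have xq : x ^+ q < 1 by rewrite exprn_ilt1 -?lt0n //; lra.
have hM : h M \in S.
  have -> : h M = t / (1 - x ^+ q).
    apply: (canRL (mulfK _)); first by rewrite gt_eqF //; lra.
    by rewrite mulrBr mulr1 {1}tE; ring.
  by rewrite Sdiv // Ssub // SX // SV.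
have -> : xi = (h M + (u M.+1)%:~R + x * (u M)%:~R) / (a ^+ M * (a + x)).
  apply: (canRL (mulfK _)).
    by rewrite mulf_neq0 ?expf_eq0 ?gt_eqF ?andbF //; lra.
  by rewrite /h /eps exprS; ring.
have xS := SV _ aS; apply: Sdiv; last by apply: SM; [exact: SX|exact: SD].
by apply: (SD (_ + _)); [exact: SD|exact: SM].
Qed.

(* The closed form of [p n / q n], see [ratio_spectrum_value]. *)
Definition spectrum_value n : R := (1 - y) * ((1 - y ^+ n) / (1 - y ^+ n.+1)) / (a + x).

Lemma spectrum_value_facts n :
  [/\ 0 < y ^+ n, y ^+ n <= 1, y ^+ n.+1 < 1 & 0 < a + x].
Proof.
have [y0 y1 yx] := y_facts a3 ab; have [a0 x0 x1 _ _] := inv_facts a3 ab.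
have yn : y ^+ n <= 1 by rewrite exprn_ile1 //; lra.
split=> //; [by rewrite exprn_gt0| |by lra].
rewrite exprS; apply: le_lt_trans (_ : y * 1 < 1); last by lra.
by rewrite ler_pM2l.
Qed.

Lemma spectrum_value_lt n : spectrum_value n < spectrum_value n.+1.
Proof.
have [y0 y1 yx] := y_facts a3 ab.
have [z0 z1 yz ax0] := spectrum_value_facts n.
have [_ _ yyz _] := spectrum_value_facts n.+1.
rewrite /spectrum_value ltr_pM2r ?invr_gt0 // ltr_pM2l; last by lra.
rewrite ltr_pdivlMr; last by lra.
rewrite mulrAC ltr_pdivrMr; last by lra.
move: z0 z1 yz yyz; rewrite !(exprS y).
move: (y) (y ^+ n) y0 y1 => t z y0 y1 z0 z1 yz yyz.
(* This is the difference (1 - t z)^2 - (1 - z) (1 - t^2 z) of the cross products. *)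
have : 0 < z * ((1 - t) * (1 - t)) by do 2 (apply: mulr_gt0 => //); lra.
by lra.
Qed.

Lemma spectrum_value_gap n :
  0 < (1 - y) / (a + x) - spectrum_value n <= y ^+ n.
Proof.
have [y0 y1 yx] := y_facts a3 ab; have [a0 x0 x1 _ _] := inv_facts a3 ab.
have h3 := a3; have [z0 z1 yz ax0] := spectrum_value_facts n.
have -> : (1 - y) / (a + x) - spectrum_value n =
    (1 - y) * (1 - y) / ((a + x) * (1 - y ^+ n.+1)) * y ^+ n.
  rewrite /spectrum_value !(exprS y); rewrite (exprS y) in yz.
  move: (y) (y ^+ n) (a + x) yz ax0 => t z w yz w0.
  by field; rewrite !gt_eqF //; lra.
have d0 : 0 < (a + x) * (1 - y ^+ n.+1) by rewrite mulr_gt0 //; lra.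
apply/andP; split.
  by rewrite mulr_gt0 // divr_gt0 // mulr_gt0; lra.
rewrite ger_pMl // ler_pdivrMr // mul1r.
apply: le_trans (_ : 1 * (1 - y ^+ n.+1) <= _); last by rewrite ler_wpM2r; lra.
rewrite mul1r; apply: le_trans (_ : 1 * (1 - y) <= _).
  by rewrite ler_wpM2r; lra.
rewrite mul1r lerD2l lerN2 (exprS y).
by rewrite ger_pMr.
Qed.

(** Binet formulas: as b ^+ 2 + 2 = a ^+ 2 + x ^+ 2, at even n one has (a + x) p n = a ^+ n - x ^+ n
    and (a - x) q n = a ^+ n.+1 - x ^+ n.+1. *)
Lemma ratio_spectrum_value (p q : nat -> int) :
  p 0%N = 0 -> p 2%N = b -> recurrence b p ->
  q 0%N = 1 -> q 2%N = b ^+ 2 + 3 -> recurrence b q ->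
  forall n, (p n)%:~R / (q n)%:~R = spectrum_value n.
Proof.
move=> p0 p2 pr q0 q2 qr; have [a0 x0 x1 ax bE] := inv_facts a3 ab.
have h3 := a3.
have b2 : (b ^+ 2 + 2)%:~R = a ^+ 2 + y :> R.
  by rewrite intrD rmorphXn /= bE -[2%:~R]/(2%:R : R); ring: ax.
have ev k : (p k.*2)%:~R * (a + x) = a ^+ k.*2 - x ^+ k.*2 /\
    (q k.*2)%:~R * (a - x) = a ^+ k.*2.+1 - x ^+ k.*2.+1 /\
    (p k.*2.+2)%:~R * (a + x) = a ^+ k.*2.+2 - x ^+ k.*2.+2 /\
    (q k.*2.+2)%:~R * (a - x) = a ^+ k.*2.+3 - x ^+ k.*2.+3.
  elim: k => [|k [ep [eq [ep2 eq2]]]].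
    rewrite p0 q0 p2 q2 !expr0 !expr1; split; first by rewrite mul0r subrr.
    split; first by rewrite mul1r.
    split; first by rewrite bE; ring.
    have -> : (b ^+ 2 + 3)%:~R = a ^+ 2 + y + 1 :> R.
      by rewrite -b2 -[1]/(1%:~R) -intrD -addrA.
    ring: ax.
  rewrite !doubleS; do 2 (split=> //).
  have [pk _] := pr k.+1 isT; have [qk _] := qr k.+1 isT.
  rewrite (_ : (2 * k.+1 + 2 = k.*2.+4)%N) in pk qk; last by lia.
  rewrite (_ : (2 * k.+1 = k.*2.+2)%N) in pk qk; last by lia.
  rewrite subn2 /= in pk qk.
  have ax2 : a ^+ 2 * y = 1 by rewrite -exprMn ax expr1n.
  split.
    rewrite pk intrB intrM b2 mulrBl -mulrA ep2 ep !exprS; ring: ax.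
  rewrite qk intrB intrM b2 mulrBl -mulrA eq2 eq !exprS; ring: ax.
move=> n; have [z0 z1 yz ax0] := spectrum_value_facts n.
have axd : 0 < a - x by lra.
have an k : a ^+ k - x ^+ k = a ^+ k * (1 - y ^+ k).
  by rewrite -exprM mulnC exprM expr2 mulrBr mulr1 mulrA -exprMn ax expr1n mul1r.
have key (P Q : R) : P * (a + x) = a ^+ n - x ^+ n ->
    Q * (a - x) = a ^+ n.+1 - x ^+ n.+1 -> P / Q = spectrum_value n.
  move=> hP hQ.
  have -> : P = (a ^+ n - x ^+ n) / (a + x) by rewrite -hP mulfK // gt_eqF.
  have -> : Q = (a ^+ n.+1 - x ^+ n.+1) / (a - x) by rewrite -hQ mulfK // gt_eqF.
  rewrite !an; have -> : a - x = a * (1 - y) by rewrite mulrBr mulr1 expr2 mulrA ax mul1r.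
  have y1 : y < 1 by have [? ? ?] := y_facts a3 ab; lra.
  have an0 : a ^+ n != 0 by rewrite expf_neq0 // gt_eqF.
  rewrite /spectrum_value [a ^+ n.+1]exprS.
  move: (a ^+ n) (y ^+ n) (y ^+ n.+1) (y) (a + x) yz y1 an0 ax0.
  move=> A z w t c yz y1 an0 c0.
  by field; rewrite an0 !gt_eqF //; lra.
have [k [nE|nE]] : exists k, n = k.*2 \/ n = k.*2.+1.
  exists n./2; have := odd_double_half n; case: odd; rewrite ?add0n ?add1n; auto.
  by apply: key; rewrite nE; have [? [? _]] := ev k.
have [ep [eq [ep2 eq2]]] := ev k.
have [_ pk] := pr k.+1 isT; have [_ qk] := qr k.+1 isT.
rewrite (_ : (2 * k.+1 - 1 = k.*2.+1)%N) in pk qk; last by lia.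
rewrite (_ : (2 * k.+1 = k.*2.+2)%N) in pk qk; last by lia.
rewrite subn2 /= in pk qk.
have axn : a + x != 0 by rewrite gt_eqF.
(* At odd n both p n and q n carry an additional factor a + x, which cancels in the quotient. *)
have e1 : (p n)%:~R / (q n)%:~R =
    ((p n)%:~R / (a + x)) / ((q n)%:~R / (a + x)).
  by rewrite invf_div mulrA divfK.
rewrite e1; apply: key; rewrite nE.
  rewrite divfK // pk intrD; apply: (mulIf axn).
  rewrite mulrDl ep ep2 !exprS; ring: ax.
rewrite mulrAC qk intrD mulrDl eq eq2; apply: (mulIf axn).
rewrite divfK // !exprS; ring: ax.
Qed.
End Construction.

(** * The bottom of the spectrum *)

Definition word_signs (v : nat -> bool) (m : nat) : int :=
  if odd m || (m == 0%N) then 0 else (v m./2)%:Z - (v m./2.-1)%:Z.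

Lemma word_signsP v : word_steps (word_signs v) v.
Proof.
by move=> j; rewrite /word_signs /= odd_double /= doubleK.
Qed.

Lemma word_signs_le1 v m : `|word_signs v m| <= 1.
Proof. by rewrite /word_signs; case: ifP => // _; case: (v _) (v _) => [] []. Qed.

(** The periodic word with a single 1 in each period; every boundary beyond the start has its first
    difference at distance P - 1. *)
Definition christoffel (P j : nat) : bool := (P %| j)%N.

Lemma christoffelD P q r : christoffel P (q * P + r) = christoffel P r.
Proof. by rewrite /christoffel dvdn_addr ?dvdn_mull. Qed.

Lemma christoffel_small P r : (0 < r < P)%N -> christoffel P r = false.
Proof. by move=> /andP[r0 rP]; rewrite /christoffel gtnNdvd. Qed.

Lemma christoffelB P q r : (0 < r < P)%N -> (r <= q * P)%N ->
  christoffel P (q * P - r) = false.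
Proof.
move=> rP rq; have q0 : (0 < q)%N by case: q rq => //; lia.
rewrite (_ : (q * P - r = q.-1 * P + (P - r))%N).
  by rewrite christoffelD christoffel_small //; lia.
have -> : (q * P = q.-1 * P + P)%N by rewrite -mulSnr prednK.
lia.
Qed.

Lemma christoffel_deep_periodic P : (1 < P)%N -> deep_periodic (christoffel P) P.
Proof.
move=> P1; split=> //.
  by exists 0%N => j _; rewrite /christoffel dvdn_addl.
move=> A; exists (A.+1 * P).-1.
have AP : (A.+1 * P = A * P + P)%N by rewrite mulSnr.
have A0 : (A <= A * P)%N by rewrite leq_pmulr //; lia.
have S : (A.+1 * P).-1.+1 = (A.+1 * P)%N by lia.
split; first by lia.
  rewrite S -subn1 christoffelB; [|lia|lia].
  by rewrite -[X in christoffel P X]addn0 christoffelD /christoffel dvdn0.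
move=> i iP; rewrite S christoffelD christoffel_small; last by lia.
rewrite (_ : ((A.+1 * P).-1 - i = A.+1 * P - i.+1)%N) ?christoffelB //; lia.
Qed.

Lemma christoffel_markoff P : (1 < P)%N -> markoff (christoffel P) P P.
Proof.
move=> P1 j Pj vj.
have v0 q : christoffel P (q * P) by rewrite /christoffel dvdn_mull.
have [j0|j0] := boolP (christoffel P j).
  have [q jE] : exists q, j = (q * P)%N by exists (j %/ P)%N; rewrite divnK.
  have qP : (P <= q * P)%N by rewrite -jE.
  exists P.-1; rewrite !jE; split.
  - by lia.
  - move=> i iP; rewrite christoffelB; [|lia|lia].
    rewrite (_ : ((q * P).+1 + i = q * P + i.+1)%N); last by lia.
    by rewrite christoffelD christoffel_small //; lia.
  - rewrite (_ : ((q * P).+1 + P.-1 = q.+1 * P)%N) ?v0 //.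
    by rewrite mulSnr; lia.
  - rewrite christoffelB; [|lia|lia].
    by rewrite -addn1 christoffelD christoffel_small.
have j1 : christoffel P j.+1.
  by move: vj j0; case: (christoffel P j) (christoffel P j.+1) => [] [].
have [q jE] : exists q, j.+1 = (q * P)%N by exists (j.+1 %/ P)%N; rewrite divnK.
have jE' : j = (q * P - 1)%N by rewrite -jE subn1.
exists P.-1; rewrite !jE; split.
- by lia.
- move=> i iP; rewrite christoffelD christoffel_small; last by lia.
  by rewrite jE' -subnDA christoffelB //; lia.
- by rewrite christoffelD christoffel_small ?(negbTE j0) //; lia.
- rewrite v0 (_ : (j - P.-1 = q.-1 * P)%N) ?v0 //.
  have q0 : (0 < q)%N by case: q jE {jE'} => //.
  have : (q * P = q.-1 * P + P)%N by rewrite -mulSnr prednK.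
  by move: jE Pj P1; clear; lia.
Qed.

(* [logn 2] takes every value infinitely often, so that two different [f] give
   words differing infinitely often. *)
Definition sparse_pos (f : nat -> bool) (k : nat) : nat :=
  (2 ^ k.+2 + f (logn 2 k))%N.

Definition sparse_word (f : nat -> bool) (j : nat) : bool :=
  `[< exists k, j = sparse_pos f k >].

Lemma sparse_word_pos f k : sparse_word f (sparse_pos f k).
Proof. by apply/asboolP; exists k. Qed.

Lemma sparse_word_near f k c : (2 ^ k.+2 <= c + k)%N -> (c <= 2 ^ k.+2 + k)%N ->
  sparse_word f c = (c == sparse_pos f k).
Proof.
move=> c1 c2; apply/asboolP/eqP => [[k' kE]|->]; last by exists k.
have [kk|kk|<-//] := ltngtP k' k.
  have : (2 ^ k'.+2 <= 2 ^ k.+1)%N by rewrite leq_exp2l //; lia.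
  have := ltn_expl k.+1 (isT : 1 < 2)%N.
  move: c1; rewrite kE /sparse_pos !expnS; case: (f _); lia.
have : (2 ^ k.+3 <= 2 ^ k'.+2)%N by rewrite leq_exp2l //; lia.
have := ltn_expl k.+1 (isT : 1 < 2)%N.
move: c2; rewrite kE /sparse_pos !expnS; case: (f _); lia.
Qed.

Lemma sparse_word_isolated f T : exists J, forall j, (J <= j)%N ->
  sparse_word f j != sparse_word f j.+1 ->
  forall i, (0 < i < T)%N ->
  sparse_word f (j.+1 + i)%N = sparse_word f (j - i)%N.
Proof.
exists (2 ^ T.+4)%N => j Jj vj.
have [k kj] : exists k, (sparse_pos f k = j \/ sparse_pos f k = j.+1).
  move: vj; have [/asboolP[k ->]|_] := boolP (sparse_word f j).
    by exists k; left.
  by have [/asboolP[k ->]|//] := boolP (sparse_word f j.+1); exists k; right.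
have kT : (T.+2 <= k)%N.
  rewrite leqNgt; apply/negP => kT.
  have : (2 ^ k.+2 <= 2 ^ T.+3)%N by rewrite leq_exp2l //; lia.
  have := ltn_expl T.+3 (isT : 1 < 2)%N.
  move: Jj kj; rewrite /sparse_pos [(2 ^ T.+4)%N]expnS.
  by case: (f _); clear; lia.
have k2 : (2 ^ k.+2 <= sparse_pos f k <= 2 ^ k.+2 + 1)%N.
  by rewrite /sparse_pos; case: (f _); lia.
have := ltn_expl k.+2 (isT : 1 < 2)%N => k3.
move=> i iT.
by rewrite !(@sparse_word_near f k); clear -k2 k3 kj kT iT; lia.
Qed.

Lemma sparse_word_changes f J :
  exists2 j, (J <= j)%N & sparse_word f j != sparse_word f j.+1.
Proof.
have J2 := ltn_expl J.+4 (isT : 1 < 2)%N.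
exists (sparse_pos f J.+2); first by rewrite /sparse_pos; clear -J2; lia.
rewrite sparse_word_pos (@sparse_word_near f J.+2) ?gtn_eqF //.
- by rewrite /sparse_pos; clear; lia.
- by rewrite /sparse_pos; case: (f _); clear; lia.
Qed.

Lemma sparse_word_inj f f' n J : f n != f' n ->
  exists2 j, (J <= j)%N & (sparse_word f j.+1)%:Z - (sparse_word f j)%:Z !=
                          (sparse_word f' j.+1)%:Z - (sparse_word f' j)%:Z.
Proof.
move=> fn; pose k := (2 ^ n * (2 * J).+1)%N.
have kn : logn 2 k = n.
  rewrite /k lognM ?expn_gt0 // pfactorK // logn_coprime ?addn0 //.
  by rewrite coprime2n mul2n /= odd_double.
have kJ : (J < k)%N.
  have : (1 * (2 * J).+1 <= k)%N by rewrite leq_mul2r expn_gt0 orbT.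
  by clear; lia.
have k2 := ltn_expl k.+2 (isT : 1 < 2)%N.
(* Just before 2 ^ k.+2 both words show 0, and at 2 ^ k.+2 a 1 appears exactly when the value of the
   defining function at n is false. *)
exists (2 ^ k.+2).-1; first by clear -kJ k2; lia.
rewrite prednK ?expn_gt0 //.
rewrite !(@sparse_word_near f k) ?(@sparse_word_near f' k);
  try by clear -kJ k2; lia.
rewrite /sparse_pos kn.
have h c : ((2 ^ k.+2).-1 == 2 ^ k.+2 + c)%N = false by clear -k2; lia.
rewrite !h -[X in X == (_ + _)%N]addn0 eqn_add2l.
rewrite -[X in X == (_ + f' n)%N]addn0 eqn_add2l.
by move: fn; case: (f n) (f' n) => [] [].
Qed.

(** * Values that occur, and the exclusion of all others below L *)

Section Spectrum.
Variables (R : realType) (a : R) (b : int).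
Hypothesis a3 : 3 < a.
Hypothesis ab : a ^+ 2 = b%:~R * a + 1.
Local Notation x := (a^-1).
Local Notation y := (x ^+ 2).
Local Notation lmax := ((1 - y) / (a + x)).

Lemma lmax_lt_half : lmax < 2^-1.
Proof.
have [y0 y1 yx] := y_facts a3 ab; have [a0 x0 x1 _ _] := inv_facts a3 ab.
by have h3 := a3; rewrite ltr_pdivrMr; lra.
Qed.

Lemma spectrum_value_lt_lmax n : spectrum_value a n < lmax.
Proof. by have /andP[] := spectrum_value_gap a3 ab n; rewrite subr_gt0. Qed.

Lemma spectrum_value0 : spectrum_value a 0 = 0.
Proof. by rewrite /spectrum_value expr0 subrr mul0r mulr0 mul0r. Qed.

Lemma spectrum_value_ge0 n : 0 <= spectrum_value a n.
Proof.
elim: n => [|n IH]; first by rewrite spectrum_value0.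
exact: le_trans IH (ltW (spectrum_value_lt a3 ab n)).
Qed.

Lemma spectrum_value_attained n : exists xi, limsup_dist a xi = spectrum_value a n.
Proof.
case: n => [|n].
  exists 0; rewrite spectrum_value0.
  apply: is_limsup_unique (limsup_dist_is_limsup a 0) _.
  have d0 m : dist_int (0 * a ^+ m) = 0.
    by rewrite mul0r (@dist_int_small _ 0 0) subrr normr0.
  split=> [e e0|e M e0]; first by exists 0%N => m _; rewrite d0 add0r ltW.
  by exists M => //; rewrite d0 sub0r oppr_le0 ltW.
have [xi [u [C [us uC]]]] := exists_orbit a3 ab (word_signs_le1 (christoffel n.+2)).
exists xi; have P1 : (1 < n.+2)%N by [].
have := deep_periodic_limsup a3 ab (fun m => orbit_recurrence ab xi (us m)) uC
  (word_signsP _) (christoffel_markoff P1) (christoffel_deep_periodic P1).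
move=> /(limsup_dist_eps (l := spectrum_value a n.+1))[|_ //].
exact: lt_trans (spectrum_value_lt_lmax _) lmax_lt_half.
Qed.

(** The integers u are kept in the conclusion because they allow f to be recovered from xi. *)
Lemma sparse_orbit f : exists xi, limsup_dist a xi = lmax /\
  exists u : nat -> int, (exists M, forall m, (M <= m)%N ->
    `|xi * a ^+ m - (u m)%:~R| < 2^-1) /\
  forall m, u m.+2 = b * u m.+1 + u m + word_signs (sparse_word f) m.
Proof.
have [xi [u [C [us uC]]]] := exists_orbit a3 ab (word_signs_le1 (sparse_word f)).
exists xi; have := sparse_limsup a3 ab (fun m => orbit_recurrence ab xi (us m)) uC
  (word_signsP _) (sparse_word_isolated f) (sparse_word_changes f).
move=> /limsup_dist_eps/(_ lmax_lt_half)[hM hl]; split=> //.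
by exists u.
Qed.

(** Two integers within less than 1/2 of the same real agree, so xi determines u, hence the steps,
    from some point on. Words of different f differ infinitely often, and f is thus injectively
    encoded in xi. *)
Lemma lmax_uncountable : ~ countable [set xi : R | limsup_dist a xi = lmax].
Proof.
move=> /countable_injP[g g_inj].
have [xi hxi] := choice sparse_orbit.
have xi_inj f f' : xi f = xi f' -> f = f'.
  move=> ff; apply/funext => n; apply/eqP; apply: contraT => fn.
  have [_ [u [[M uM] us]]] := hxi f; have [_ [u' [[M' uM'] us']]] := hxi f'.
  have uu m : (M + M' <= m)%N -> u m = u' m.
    move=> Mm; have h1 := uM m ltac:(clear -Mm; lia).
    have h2 := uM' m ltac:(clear -Mm; lia); rewrite -ff in h2.
    apply/eqP; rewrite -subr_eq0 -normr_eq0 eq_le normr_ge0 andbT -ltz1D addr0.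
    rewrite -(ltr_int R) intr_norm intrB.
    have := ler_distD (xi f * a ^+ m) (u m)%:~R (u' m)%:~R.
    by rewrite (distrC (u m)%:~R (xi f * _)); move: h1 h2; lra.
  have [j Jj] := sparse_word_inj (M + M') fn.
  have [_ <-] := word_signsP (sparse_word f) j.
  have [_ <-] := word_signsP (sparse_word f') j.
  have e1 := us j.*2.+2; have e2 := us' j.*2.+2.
  rewrite !uu in e1; [|clear -Jj; lia|clear -Jj; lia|clear -Jj; lia].
  by rewrite e2 in e1; move/addrI: e1 => ->; rewrite eqxx.
(* An enumeration would inject all functions nat -> bool into nat; the diagonal of a left inverse
   refutes this. *)
pose G f := g (xi f).
have G_inj : injective G.
  move=> f f' ff; apply: xi_inj; apply: g_inj ff; rewrite inE /=;
    [exact: (hxi f).1|exact: (hxi f').1].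
have [F hF] : {F : nat -> nat -> bool & forall n, (exists f, G f = n) -> G (F n) = n}.
  apply: (choice (P := fun n f => (exists f', G f' = n) -> G f = n)) => n.
  have [[f fn]|nf] := pselect (exists f, G f = n).
    by exists f.
  by exists xpred0 => /nf.
have FG f : F (G f) = f by apply: G_inj; apply: hF; exists f.
pose diag n := ~~ F n n.
have : F (G diag) (G diag) = ~~ F (G diag) (G diag) by rewrite {1}FG.
by case: (F _ _).
Qed.

Lemma spectrum_below_lmax xi : limsup_dist a xi < lmax ->
  (exists n, limsup_dist a xi = spectrum_value a n) /\ rat_adjoin a xi.
Proof.
move=> hl; set l := limsup_dist a xi in hl *.
have [y0 y1 yx] := y_facts a3 ab; have [a0 x0 x1 _ _] := inv_facts a3 ab.
have ax0 : 0 < a + x by lra.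
have h3 := a3.
have [u hu] := choice (fun m => near_int (xi * a ^+ m)).
pose eps m := xi * a ^+ m - (u m)%:~R.
have epsl : is_limsup (fun m => `|eps m|) l.
  have := limsup_dist_is_limsup a xi.
  by under eq_fun => m do rewrite (dist_int_small (hu m)).
pose s m := u m.+2 - b * u m.+1 - u m.
have us m : u m.+2 = b * u m.+1 + u m + s m by rewrite /s; ring.
have epsS m : eps m.+2 = b%:~R * eps m.+1 + eps m - (s m)%:~R.
  exact: orbit_recurrence.
(* Eventually vanishing steps, from an eventually constant word or from no late nonzero step, give
   the value with n = 0. *)
have zero M : (forall m, (M <= m)%N -> s m = 0) ->
    (exists n, l = spectrum_value a n) /\ rat_adjoin a xi.
  move=> sz; split; last first.
    apply: (rat_adjoin_of_periodic a3 ab us hu (isT : 0 < 1)%N (M := M)) => m Mm.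
    by rewrite !sz //; clear -Mm; lia.
  exists 0%N; rewrite spectrum_value0; apply: is_limsup_unique epsl _.
  split=> [e e0|e M' e0]; last first.
    by exists M' => //; rewrite sub0r (le_trans _ (normr_ge0 _)) // oppr_le0 ltW.
  have [|N hN] := @expr_small R x (e / 2) _ ltac:(lra).
    by apply/andP; split; lra.
  exists (M + N).+1 => -[//|m] Mm.
  have := orbit_center_le a3 ab epsS hu (N := N) (m := m) ltac:(clear -Mm; lia).
  rewrite sz; last by clear -Mm; lia.
  rewrite big1 => [|j _]; last first.
    have jN := ltn_ord j; rewrite /window !sz ?oppr0 ?if_same ?mulr0 //.
      by clear -Mm jN; lia.
    by clear -Mm jN; lia.
  rewrite addr0 subr0 normrM (gtr0_norm ax0) add0r => h.
  have := hN N (leqnn N).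
  have : 1 * `|eps m.+1| <= (a + x) * `|eps m.+1| by rewrite ler_wpM2r //; lra.
  by lra.
(* Half of the margin absorbs the approach to the limsup, the other half is left for
   [orbit_lex_neg]. *)
have [d d0 hd] : exists2 d, 0 < d & (a + x) * l + 2 * d <= 1 - y.
  exists ((1 - y - (a + x) * l) / 2); last by lra.
  by move: hl; rewrite ltr_pdivlMr // mulrC; lra.
have [h1 _] := epsl; have [M0 hM0] := h1 (d / (a + x)) ltac:(by rewrite divr_gt0).
have [|M [N sP]] := orbit_lex_neg a3 ab epsS hu d0 (M0 := M0).
  move=> m /hM0; rewrite -(ler_pM2l ax0) mulrDr mulrCA divff ?gt_eqF // mulr1.
  by lra.
have [[m0 [Mm0 sm0]]|ns] :=
    pselect (exists m, (M + 3 + N.+1 * N.+1 <= m)%N /\ s m != 0); last first.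
  apply: (zero (M + 3 + N.+1 * N.+1)%N) => m Mm; apply/eqP; apply: contraT => sm.
  by case: ns; exists m.
pose v := word_of s m0.
have vP t := word_ofP sP Mm0 sm0 t.
have sv : word_steps (fun m => s (m0 + m)%N) v by exact: vP.
have mv : markoff v N N := word_of_markoff sP Mm0 sm0.
have [[J [c vc]]|[P vPer]] := markoff_tame mv.
  apply: (zero (m0 + J.*2.+1)%N) => m Mm.
  rewrite -(subnKC (leq_trans (leq_addr _ _) Mm)).
  have : (J.*2.+1 <= m - m0)%N by clear -Mm; lia.
  move: (m - m0)%N => i Ji; have [oi|ei] := boolP (odd i).
    by rewrite (word_steps_odd sv).
  have iE : i = (i./2.-1).*2.+2 by clear -Ji ei; lia.
  by rewrite iE (sv _).2 !vc ?subrr //; clear -Ji iE; lia.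
have [P1 [J vJ] _] := vPer; split.
  exists P.-1; rewrite /spectrum_value prednK; last by clear -P1; lia.
  apply: is_limsup_unique epsl _; apply: (@is_limsup_shift _ _ _ m0).
  apply: (deep_periodic_limsup a3 ab _ (fun m => hu (m0 + m)%N) sv mv vPer) => m.
  by rewrite !addnS -/(eps _) epsS.
(* The period doubles because the letters of [v] occupy every second position of s. *)
apply: (rat_adjoin_of_periodic a3 ab us hu (q := P.*2) (M := (m0 + J.*2.+1)%N)).
  by rewrite double_gt0; clear -P1; lia.
move=> m Mm; rewrite -(subnKC (leq_trans (leq_addr _ _) Mm)).
have : (J.*2.+1 <= m - m0)%N by clear -Mm; lia.
rewrite -addnA; move: (m - m0)%N => i Ji; have [oi|ei] := boolP (odd i).
  by rewrite !(word_steps_odd sv) // oddD odd_double addbF.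
have iE : i = (i./2.-1).*2.+2 by clear -Ji ei; lia.
rewrite iE (_ : (i./2.-1.*2.+2 + P.*2 = (i./2.-1 + P).*2.+2)%N); last by clear; lia.
rewrite (sv (i./2.-1 + P)%N).2 (sv _).2 -addSn !vJ //.
  by clear -Ji iE; lia.
by clear -Ji iE; lia.
Qed.

End Spectrum.

(** * Quadratic units *)

Section QuadraticUnit.
Variable R : realType.
Implicit Types (f : {poly rat}) (z : R).

Lemma minimal_poly_dvd z f g : minimal_poly z f -> root (map_poly ratr g) z ->
  f %| g.
Proof.
move=> [fm [f1 firr] fz] gz.
have [|nc] := boolP (coprimep f g).
  move=> /Bezout_eq1_coprimepP[[c d] /= cd].
  have := congr1 (fun q => (map_poly ratr q).[z]) cd.
  rewrite rmorphD !rmorphM rmorph1 /= hornerD !hornerM hornerC.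
  by rewrite (rootP fz) (rootP gz) !mulr0 addr0 => /eqP; rewrite eq_sym oner_eq0.
have := firr (gcdp f g) nc (dvdp_gcdl _ _).
by move=> /eqp_dvdl <-; exact: dvdp_gcdr.
Qed.

Lemma minimal_poly_unique z f g : minimal_poly z f -> minimal_poly z g -> f = g.
Proof.
move=> hf hg; apply/eqP; rewrite -eqp_monic.
- by rewrite /eqp (minimal_poly_dvd hf) ?(minimal_poly_dvd hg) //;
    [case: hf|case: hg].
- by case: hf.
- by case: hg.
Qed.

(** Gauss's lemma: f is proportional to an integer factor g of a monic integer polynomial, so the
    leading coefficient of g is 1 or -1. *)
Lemma minimal_poly_int z f : algebraic_integer z -> minimal_poly z f ->
  exists g : {poly int}, f = map_poly intr g.
Proof.
move=> [P Pm Pz] hf.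
have /(minimal_poly_dvd hf)/dvdpP_rat_int[g [c c0 fE] [r PE]] :
    root (map_poly ratr (map_poly (intr : int -> rat) P)) z.
  rewrite -map_poly_comp (@eq_map_poly _ _ _ intr) // => i /=.
  by rewrite ratr_int.
have [fm _ _] := hf.
have lc1 : lead_coef g * lead_coef r = 1 by rewrite -lead_coefM -PE (monicP Pm).
have cg : c * (lead_coef g)%:~R = 1.
  have intrI : injective (intr : int -> rat) by apply: intr_inj.
  by have := monicP fm; rewrite fE lead_coefZ (lead_coef_map_inj intrI).
have [lg|lg] : lead_coef g = 1 \/ lead_coef g = -1.
  have := congr1 absz lc1; rewrite abszM => /eqP; rewrite muln_eq1.
  by move=> /andP[/eqP h _]; lia.
  exists g; rewrite fE; move: cg; rewrite lg mulr1 => ->; exact: scale1r.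
exists (- g); rewrite fE rmorphN /=; move: cg.
rewrite lg mulrN1 => /(canRL (@opprK _)) ->.
by rewrite scaleN1r.
Qed.

(** The constant coefficient of the minimal polynomial is z * z2 < 0. Integrality of z^-1 makes it
    invertible in the integers, so it is -1. *)
Lemma quadratic_unit_trace z z2 : 0 < z -> quadratic_unit z ->
  conjugate_over_rat z z2 -> z2 < 0 ->
  exists b : int, z ^+ 2 = b%:~R * z + 1.
Proof.
move=> z0 [zint zVint [f hf f3]] [f' hf' fz2] z20.
rewrite (minimal_poly_unique hf' hf) {f' hf'} in fz2.
have [g gE] := minimal_poly_int zint hf.
have [fm firr fz] := hf.
have coefE i : f`_i = (g`_i)%:~R :> rat by rewrite gE coef_map.
have fval t : (map_poly ratr f : {poly R}).[t] = (g`_0)%:~R + (g`_1)%:~R * t + t ^+ 2.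
  rewrite horner_coef size_map_poly f3 !big_ord_recl big_ord0 /=.
  have f2 : f`_2 = 1 by move: fm; rewrite monicE lead_coefE f3 => /eqP.
  rewrite !coef_map /= f2 !coefE !ratr_int rmorph1 /bump /=.
  by rewrite expr0 expr1 mulr1 addr0 mul1r addrA.
have e1 : (g`_0)%:~R + (g`_1)%:~R * z + z ^+ 2 = 0 by rewrite -fval (rootP fz).
have e2 : (g`_0)%:~R + (g`_1)%:~R * z2 + z2 ^+ 2 = 0 by rewrite -fval (rootP fz2).
have prod : (g`_0)%:~R = z * z2.
  have nz : z - z2 != 0 by rewrite gt_eqF //; lra.
  apply: (mulfI nz).
  have : z2 * ((g`_0)%:~R + (g`_1)%:~R * z + z ^+ 2) -
    z * ((g`_0)%:~R + (g`_1)%:~R * z2 + z2 ^+ 2) = 0.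
    by rewrite e1 e2 !mulr0 subrr.
  by move: (_%:~R) (_%:~R) => c d; lra.
have g0 : g`_0 < 0 by rewrite -(ltrz0 R) prod nmulr_llt0.
have g0n : (g`_0)%:~R != 0 :> rat by rewrite intr_eq0 lt_eqF.
have froot (t : rat) : ~~ root f t.
  apply/negP => ft; have := firr ('X - t%:P).
  rewrite size_XsubC dvdp_XsubCl => /(_ isT ft) /eqp_size.
  by rewrite size_XsubC f3.
(* The monic reciprocal of f. It is the minimal polynomial of z^-1, so its constant coefficient, the
   inverse of that of f, is an integer. *)
pose h : {poly rat} := 'X^2 + (((g`_1)%:~R / (g`_0)%:~R) *: 'X + ((g`_0)%:~R^-1)%:P).
have sl (c d : rat) : (size (c *: 'X + d%:P)%R < 3)%N.
  apply: leq_ltn_trans (size_polyD _ _) _; rewrite gtn_max; apply/andP; split.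
    by apply: leq_ltn_trans (size_scale_leq _ _) _; rewrite size_polyX.
  by apply: leq_ltn_trans (size_polyC_leq1 _) _.
have h3 : size h = 3%N by rewrite /h size_polyDl size_polyXn.
have hmin : minimal_poly z^-1 h.
  split.
  - by rewrite monicE /h lead_coefDl ?lead_coefXn // size_polyXn.
  - apply: cubic_irreducible; first by rewrite h3.
    move=> t; apply/negP => /rootP.
    rewrite /h hornerD hornerXn hornerD hornerZ hornerX hornerC => ht.
    have t0 : t != 0.
      apply/eqP => t0; move: ht; rewrite t0 ?expr2 !mulr0 !add0r => /eqP.
      by rewrite invr_eq0 (negbTE g0n).
    have := froot t^-1; rewrite rootE horner_coef f3 !big_ord_recl big_ord0 /=.
    have f2 : f`_2 = 1 by move: fm; rewrite monicE lead_coefE f3 => /eqP.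
    rewrite /bump /= f2 !coefE expr0.
    suff -> : (g`_0)%:~R * 1 + ((g`_1)%:~R * t^-1 ^+ 1 + (1 * t^-1 ^+ 2 + 0)) =
        (g`_0)%:~R / t ^+ 2 * (t ^+ 2 + ((g`_1)%:~R / (g`_0)%:~R * t + (g`_0)%:~R^-1)) :> rat.
      by rewrite ht mulr0 eqxx.
    by field; rewrite g0n t0.
  - have z0' : z != 0 by rewrite gt_eqF.
    have g0R : (g`_0)%:~R != 0 :> R by rewrite intr_eq0 lt_eqF.
    rewrite rootE /h !rmorphD /= map_polyXn map_polyZ /= map_polyX map_polyC /=.
    rewrite hornerD hornerXn hornerD hornerZ hornerX hornerC fmorphV fmorph_div /= !ratr_int.
    have -> : z^-1 ^+ 2 + ((g`_1)%:~R / (g`_0)%:~R * z^-1 + (g`_0)%:~R^-1) =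
       ((g`_0)%:~R + (g`_1)%:~R * z + z ^+ 2) / ((g`_0)%:~R * z ^+ 2).
      by field; rewrite g0R z0'.
    by rewrite e1 mul0r.
have [g' g'E] := minimal_poly_int zVint hmin.
have h0 : (g`_0)%:~R^-1 = (g'`_0)%:~R :> rat.
  have <- : h`_0 = (g'`_0)%:~R by rewrite g'E coef_map.
  rewrite /h.
  by rewrite !coefD coefXn coefZ coefX coefC /= mulr0 !add0r.
have u0 : g`_0 * g'`_0 = 1.
  by apply: (@intr_inj rat); rewrite intrM -h0 divff.
have g0E : g`_0 = -1.
  have := congr1 absz u0; rewrite abszM => /eqP; rewrite muln_eq1.
  by move=> /andP[/eqP h' _]; move: g0 h'; clear; lia.
exists (- g`_1); move: e1; rewrite g0E intrN; lra.
Qed.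
End QuadraticUnit.

Theorem theorem4p3 (R : realType) (alpha alpha2 : R)
    (halpha : 3 < alpha) (hunit : quadratic_unit alpha)
    (hconj : conjugate_over_rat alpha alpha2) (hneg : alpha2 < 0) :
  (exists b : int, 0 < b /\ root ('X^2 - (b%:~R)%:P * 'X - 1) alpha) /\
  (forall b : int, 0 < b -> root ('X^2 - (b%:~R)%:P * 'X - 1) alpha ->
   forall p q : nat -> int,
     p 0%N = 0 -> p 2%N = b -> recurrence b p ->
     q 0%N = 1 -> q 2%N = b ^+ 2 + 3 -> recurrence b q ->
   let r : nat -> R := fun n => (p n)%:~R / (q n)%:~R in
   let L : R := b%:~R / (1 + alpha ^+ 2) in
   [/\ increasing_seq r,
       r @ \oo --> L,
       [set limsup_dist alpha xi | xi in [set: R]] `&` `[0, L]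
         = range r `|` [set L],
       (forall n : nat,
          [set xi : R | limsup_dist alpha xi = r n] `<=` rat_adjoin alpha)
     & ~ countable [set xi : R | limsup_dist alpha xi = L]]).
Proof.
have rootE b : root ('X^2 - (b%:~R)%:P * 'X - 1) alpha <->
    alpha ^+ 2 = b%:~R * alpha + 1.
  rewrite rootE !(hornerD, hornerN, hornerM, hornerX, hornerXn, hornerC).
  by rewrite -addrA -opprD subr_eq0; split=> [/eqP|/eqP].
split.
  have a0 : 0 < alpha by lra.
  have [b ab] := quadratic_unit_trace a0 hunit hconj hneg.
  exists b; split; last by apply/rootE.
  have [_ x0 x1 _ bE] := inv_facts halpha ab.
  by rewrite -(ltr0z R) bE; lra.
move=> b b0 /rootE ab p q p0 p2 pr q0 q2 qr r L.
have rE : r = spectrum_value alpha.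
  by apply/funext => n; exact: (ratio_spectrum_value halpha ab).
have [a0 x0 x1 ax bE] := inv_facts halpha ab.
have [y0 y1 yx] := y_facts halpha ab.
have LE : L = (1 - alpha^-1 ^+ 2) / (alpha + alpha^-1).
  have e1 : 1 + alpha ^+ 2 = alpha * (alpha + alpha^-1) by ring: ax.
  have e2 : b%:~R = alpha * (1 - alpha^-1 ^+ 2) by rewrite bE; ring: ax.
  by rewrite /L e1 e2 -mulf_div divff ?mul1r // gt_eqF //.
rewrite {}rE {}LE {r L}; split.
- by apply/increasing_seqP => n; exact: spectrum_value_lt halpha ab _.
- apply/cvgrPdist_le => e e0.
  have [|N hN] := @expr_small R (alpha^-1 ^+ 2) e _ e0.
    by apply/andP; split; lra.
  exists N => // n Nn /=.
  have /andP[g0 g1] := spectrum_value_gap halpha ab n.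
  by rewrite gtr0_norm // (le_trans g1) // hN.
- apply/seteqP; split=> [_ [[xi _ <-]]|_ [[n _ <-]|->]].
  + rewrite /= in_itv /= => /andP[_]; rewrite le_eqVlt => /orP[/eqP ->|hl].
      by right.
    by have [[n ->] _] := spectrum_below_lmax halpha ab hl; left; exists n.
  + have [xi e] := spectrum_value_attained halpha ab n.
    split; first by exists xi.
    rewrite /= in_itv /= (spectrum_value_ge0 halpha ab).
    exact: ltW (spectrum_value_lt_lmax halpha ab _).
  + have [xi [e _]] := sparse_orbit halpha ab xpred0.
    split; first by exists xi.
    rewrite /= in_itv /= lexx andbT.
    by rewrite (le_trans (spectrum_value_ge0 halpha ab 0)) // ltW //
      (spectrum_value_lt_lmax halpha ab).
- move=> n xi /= e; have [|_ //] := @spectrum_below_lmax _ _ _ halpha ab xi.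
  by rewrite e (spectrum_value_lt_lmax halpha ab).
- exact: lmax_uncountable halpha ab.
Qed.
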